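(* Let $f:\mathbb R^n\to\mathbb R$ be a non-degenerate polynomial with $f(0)=0$, and let $k\ge1$. Then $$[\mathcal A_k(f)]=\sum_{\gamma}\bigl((\mathbb L-1)^n-[X_\gamma]\bigr)P_k(\gamma)+(\mathbb L-1)\sum_\gamma[X_\gamma]\,Q_k(\gamma),$$ and $$[\mathcal A^\pm_k(f)]=\sum_\gamma[X^\pm_\gamma]\,P_k(\gamma)+\sum_\gamma[X_\gamma]\,Q_k(\gamma),$$ where $\gamma$ runs over the faces of $\Gamma_+(f)$, $$P_k(\gamma)=\sum_{a\in\mathbb N^n,\ a_i>0\ \forall i,\ \gamma_f(a)=\gamma,\ m_f(a)=k}\mathbb L^{-s(a)},\qquad Q_k(\gamma)=\sum_{a\in\mathbb N^n,\ a_i>0\ \forall i,\ \gamma_f(a)=\gamma,\ m_f(a)<k}\mathbb L^{-k+m_f(a)-s(a)}.$$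
   Context: $K_0$ is the Grothendieck ring of real algebraic varieties (free abelian group on isomorphism classes $[X]$ modulo $[X]=[Y]+[X\setminus Y]$ for closed $Y\subset X$, product from cartesian product), $\mathbb L=[\mathbb R]$; values are taken in the completion of $K_0[\mathbb L^{-1}]$ with respect to the dimension filtration, in which the (possibly infinite) sums above make sense. A formal arc at $0$ is $\alpha=(\alpha_1,\dots,\alpha_n)$ with $\alpha_i\in t\mathbb R[[t]]$; $p_m$ is truncation mod $t^{m+1}$ onto the jet space $L_m\cong\mathbb R^{mn}$; $[\mathcal A]=\lim_m[p_m(\mathcal A)]\mathbb L^{-mn}$. $\mathcal A_k(f)$ is the set of arcs with $f\circ\alpha=ct^k+\cdots$, $c\ne0$, and $\mathcal A_k^\pm(f)$ the set with $c=\pm1$. Write $f=\sum_\nu c_\nu x^\nu$; $\Gamma_+(f)$ is the convex hull of $\bigcup_{c_\nu\ne0}(\nu+\mathbb R^n_{\ge0})$. For $a\in\mathbb R^n_{\ge0}$: $m_f(a)=\min\{\langle a,\nu\rangle:\nu\in\Gamma_+(f)\}$, $\gamma_f(a)=\{\nu\in\Gamma_+(f):\langle a,\nu\rangle=m_f(a)\}$, $s(a)=\sum_ia_i$. For a face $\gamma$: $f_\gamma=\sum_{\nu\in\gamma}c_\nu x^\nu$, $X_\gamma=\{c\in(\mathbb R^* )^n:f_\gamma(c)=0\}$, $X^\pm_\gamma=\{c\in(\mathbb R^* )^n:f_\gamma(c)=\pm1\}$. Non-degenerate: for every compact face $\gamma$, $\nabla f_\gamma(c)\ne0$ for all $c\in(\mathbb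 R^* )^n$ with $f_\gamma(c)=0$. *)

(* Defs.v *)
From mathcomp Require Import all_boot all_order all_algebra.
From mathcomp Require Import boolp classical_sets reals topology function_spaces.
From mathcomp Require Import Rstruct Rstruct_topology.
From mathcomp Require Import mpoly.

Set Implicit Arguments.
Unset Strict Implicit.
Unset Printing Implicit Defensive.

Import Order.TTheory GRing.Theory Num.Theory.
Import ArrowAsProduct.
Local Open Scope ring_scope.
Local Open Scope classical_set_scope.

Notation R := Rdefinitions.R.

Definition ev (N : nat) (p : {mpoly R[N]}) (x : 'I_N -> R) : R := meval x p.

Definition zclosed (N : nat) (X : set ('I_N -> R)) : Prop :=
  exists s : seq {mpoly R[N]},
    X = [set x | all (fun p => ev p x == 0) s].

(* Zariski locally closed subsets of R^N: these are the real algebraic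
   varieties considered (quasi-affine real algebraic varieties). *)
Definition lclosed (N : nat) (X : set ('I_N -> R)) : Prop :=
  exists C D : set ('I_N -> R), zclosed C /\ zclosed D /\ X = C `\` D.

Definition regular (N M : nat) (X : set ('I_N -> R))
    (phi : ('I_N -> R) -> ('I_M -> R)) : Prop :=
  forall j : 'I_M, exists p q : {mpoly R[N]},
    forall x, X x -> ev q x != 0 /\ phi x j = ev p x / ev q x.

Record gen := Gen { gdim : nat; gset : set ('I_gdim -> R) }.
Arguments gset : clear implicits.

Definition biso (g1 g2 : gen) : Prop :=
  exists (phi : ('I_(gdim g1) -> R) -> ('I_(gdim g2) -> R))
         (psi : ('I_(gdim g2) -> R) -> ('I_(gdim g1) -> R)),
    regular (gset g1) phi /\ regular (gset g2) psi /\
    (forall x, gset g1 x -> gset g2 (phi x) /\ psi (phi x) = x) /\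
    (forall y, gset g2 y -> gset g1 (psi y) /\ phi (psi y) = y).

Definition glclosed (g : gen) : Prop := lclosed (gset g).

Definition gprod (g1 g2 : gen) : gen :=
  @Gen (gdim g1 + gdim g2)
    [set z | gset g1 (fun j => z (lshift (gdim g2) j)) /\
             gset g2 (fun j => z (rshift (gdim g1) j))].

Definition affine (d : nat) : gen := @Gen d setT.

(* Dimension: dim X <= d (d : int; negative d means X is empty).  The
   dimension of a real algebraic set is the maximal number of coordinate
   functions that are algebraically independent on X. *)
Definition dimle (g : gen) (d : int) : Prop :=
  match d with
  | Posz d' => forall sigma : 'I_d'.+1 -> 'I_(gdim g), injective sigma ->
      exists P : {mpoly R[d'.+1]}, P != 0 /\
        forall x, gset g x -> ev P (fun j => x (sigma j)) = 0
  | Negz _ => gset g = set0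
  end.

(* Element of the free abelian group on varieties. *)
Definition fsum0 := seq (int * gen).

Definition coef (x : fsum0) (g : gen) : int :=
  \sum_(p <- x) (if `[< p.2 = g >] then p.1 else 0).

Definition relgen (r : fsum0) : Prop :=
  (exists g1 g2 : gen, glclosed g1 /\ glclosed g2 /\ biso g1 g2 /\
      r = [:: (1, g1); (-1, g2)]) \/
  (exists (N : nat) (X C : set ('I_N -> R)), lclosed X /\ zclosed C /\
      r = [:: (1, @Gen N X); (-1, @Gen N (X `&` C)); (-1, @Gen N (X `\` C))]).

Definition K0zero (x : fsum0) : Prop :=
  exists (m : nat) (z : 'I_m -> int) (r : 'I_m -> fsum0),
    (forall t, relgen (r t)) /\
    forall g, coef x g = \sum_(t < m) z t * coef (r t) g.

(* Element of K_0[L^-1]: formal sum of terms c [X] L^(-i),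
   represented by ((c, i), X). *)
Definition fsum := seq ((int * nat) * gen).

(* x represents 0 in K_0[L^-1]: after multiplication by a large power L^J
   (L^j [X] = [X x R^j]) it represents 0 in K_0. *)
Definition Lzero (x : fsum) : Prop :=
  exists J : nat, all (fun p => (p.1.2 <= J)%N) x /\
    K0zero [seq (p.1.1, gprod p.2 (affine (J - p.1.2))) | p <- x].

Definition fopp (x : fsum) : fsum := [seq ((- p.1.1, p.1.2), p.2) | p <- x].
Definition fadd (x y : fsum) : fsum := x ++ y.
Definition fsub (x y : fsum) : fsum := x ++ fopp y.
Definition fmul (x y : fsum) : fsum :=
  [seq ((p.1.1 * q.1.1, (p.1.2 + q.1.2)%N), gprod p.2 q.2) | p <- x, q <- y].
Definition cls (g : gen) : fsum := [:: ((1, 0%N), g)].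
Definition Lneg (i : nat) : fsum := [:: ((1, i), affine 0)].
Definition fone : fsum := Lneg 0.
Definition fL : fsum := cls (affine 1).
Definition fpow (x : fsum) (e : nat) : fsum := iter e (fmul x) fone.

(* x lies in F_M K_0[L^-1], the subgroup generated by the [X] L^(-i)
   with dim X - i <= -M. *)
Definition inF (M : nat) (x : fsum) : Prop :=
  exists (m : nat) (c : 'I_m -> int) (i : 'I_m -> nat) (g : 'I_m -> gen),
    (forall t, glclosed (g t) /\ dimle (g t) ((i t)%:Z - M%:Z)) /\
    Lzero (fsub x [seq ((c t, i t), g t) | t <- enum 'I_m]).

(* a_N - b_N -> 0 in the completion of K_0[L^-1] w.r.t. the dimension
   filtration; i.e. lim a_N = lim b_N in the completion. *)
Definition same_limit (a b : nat -> fsum) : Prop :=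
  forall M : nat, exists N0 : nat, forall N, (N0 <= N)%N -> inF M (fsub (a N) (b N)).

(* A formal arc alpha = (alpha_1,...,alpha_n), alpha i l = coefficient of t^l
   in alpha_i; it is an arc at 0 when alpha i 0 = 0. *)
Definition arc (n : nat) := 'I_n -> nat -> R.

Definition comp_coef (n : nat) (f : {mpoly R[n]}) (alpha : arc n) (j : nat) : R :=
  (mmap (@polyC R) (fun i => \poly_(l < j.+1) alpha i l) f)`_j.

Definition Ak (n : nat) (f : {mpoly R[n]}) (k : nat) : set (arc n) :=
  [set alpha | (forall i, alpha i 0%N = 0) /\
     (forall j, (j < k)%N -> comp_coef f alpha j = 0) /\ comp_coef f alpha k != 0].

Definition Akpm (n : nat) (f : {mpoly R[n]}) (k : nat) (s : bool) : set (arc n) :=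
  [set alpha | (forall i, alpha i 0%N = 0) /\
     (forall j, (j < k)%N -> comp_coef f alpha j = 0) /\
     comp_coef f alpha k = (if s then 1 else -1)].

(* truncation p_N onto the jet space L_N = R^(N n), coordinates (i, l),
   i < n, 1 <= l <= N *)
Definition jetv (n N : nat) (alpha : arc n) : 'I_#|{: 'I_n * 'I_N}| -> R :=
  fun p => let il := enum_val p in alpha il.1 (il.2).+1.

Definition pjet (n N : nat) (A : set (arc n)) : gen :=
  @Gen #|{: 'I_n * 'I_N}| [set v | exists alpha, A alpha /\ v = @jetv n N alpha].

Definition jetseq (n : nat) (A : set (arc n)) (N : nat) : fsum :=
  [:: ((1, (N * n)%N), @pjet n N A)].

Definition expv (n : nat) (m : 'X_{1..n}) : 'I_n -> R := fun i => (m i)%:R.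

Definition convex_set (n : nat) (C : set ('I_n -> R)) : Prop :=
  forall x y, C x -> C y -> forall t : R, 0 <= t -> t <= 1 ->
    C (fun i => (1 - t) * x i + t * y i).

Definition newton_gens (n : nat) (f : {mpoly R[n]}) : set ('I_n -> R) :=
  [set p | exists2 m, m \in msupp f & forall i, expv m i <= p i].

Definition Gamma (n : nat) (f : {mpoly R[n]}) : set ('I_n -> R) :=
  [set p | forall C, convex_set C -> newton_gens f `<=` C -> C p].

Definition dotp (n : nat) (a p : 'I_n -> R) : R := \sum_i a i * p i.

Definition mf (n : nat) (f : {mpoly R[n]}) (a : 'I_n -> R) : R :=
  inf [set dotp a p | p in Gamma f].

Definition gammaf (n : nat) (f : {mpoly R[n]}) (a : 'I_n -> R) : set ('I_n -> R) :=
  [set p | Gamma f p /\ dotp a p = mf f a].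

(* faces of Gamma_+(f) (all faces of a polyhedron are exposed; supporting
   directions of Gamma_+(f) are in R^n_{>=0}) *)
Definition face (n : nat) (f : {mpoly R[n]}) (g : set ('I_n -> R)) : Prop :=
  exists a : 'I_n -> R, (forall i, 0 <= a i) /\ g = gammaf f a.

Definition fface (n : nat) (f : {mpoly R[n]}) (g : set ('I_n -> R)) : {mpoly R[n]} :=
  \sum_(m <- msupp f | `[< g (expv m) >]) mcoeff m f *: mpolyX R m.

Definition newton_nondegenerate (n : nat) (f : {mpoly R[n]}) : Prop :=
  forall g, face f g -> compact g ->
    forall c : 'I_n -> R, (forall i, c i != 0) -> ev (fface f g) c = 0 ->
      exists i, ev (mderiv i (fface f g)) c != 0.

Definition Xg (n : nat) (f : {mpoly R[n]}) (g : set ('I_n -> R)) : gen :=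
  @Gen n [set c | (forall i, c i != 0) /\ ev (fface f g) c = 0].

Definition Xgpm (n : nat) (f : {mpoly R[n]}) (g : set ('I_n -> R)) (s : bool) : gen :=
  @Gen n [set c | (forall i, c i != 0) /\ ev (fface f g) c = (if s then 1 else -1)].

(* The series P_k and Q_k, truncated to a in {1..N}^n (partial sums).      *)

Definition avec (n N : nat) (a : {ffun 'I_n -> 'I_N.+1}) : 'I_n -> R :=
  fun i => ((a i : nat))%:R.
Definition sa (n N : nat) (a : {ffun 'I_n -> 'I_N.+1}) : nat := (\sum_i (a i : nat))%N.
Definition apos (n N : nat) (a : {ffun 'I_n -> 'I_N.+1}) : bool := [forall i, (0 < a i)%N].

Definition Pk (n : nat) (f : {mpoly R[n]}) (k N : nat) (g : set ('I_n -> R)) : fsum :=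
  flatten [seq (if `[< apos a /\ gammaf f (avec a) = g /\ mf f (avec a) = k%:R >]
                then Lneg (sa a) else [::]) | a <- enum {ffun 'I_n -> 'I_N.+1}].

Definition Qk (n : nat) (f : {mpoly R[n]}) (k N : nat) (g : set ('I_n -> R)) : fsum :=
  flatten [seq flatten [seq
     (if `[< apos a /\ gammaf f (avec a) = g /\ mf f (avec a) = j%:R >]
      then Lneg (k - j + sa a)%N else [::]) | j <- iota 0 k]
   | a <- enum {ffun 'I_n -> 'I_N.+1}].


Definition fsumL (T : Type) (l : seq T) (F : T -> fsum) : fsum := flatten (map F l).

Definition rhsA (n : nat) (f : {mpoly R[n]}) (k : nat)
    (fl : seq (set ('I_n -> R))) (N : nat) : fsum :=
  fadd (fsumL fl (fun g => fmul (fsub (fpow (fsub fL fone) n) (cls (Xg f g))) (Pk f k N g)))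
       (fmul (fsub fL fone) (fsumL fl (fun g => fmul (cls (Xg f g)) (Qk f k N g)))).

Definition rhsApm (n : nat) (f : {mpoly R[n]}) (k : nat) (s : bool)
    (fl : seq (set ('I_n -> R))) (N : nat) : fsum :=
  fadd (fsumL fl (fun g => fmul (cls (Xgpm f g s)) (Pk f k N g)))
       (fsumL fl (fun g => fmul (cls (Xg f g)) (Qk f k N g))).

(* Main.v *)
(* Fix N >= k and cut the jet space R^(nN) along the orders a = (a_1, ..., a_n) of the
   components. Jets with a component zero modulo t^(N+1) form a variety of dimension at
   most N(n-1), negligible after division by L^(nN). On a jet of order a with leading
   coefficients c, the first possible coefficient of f(alpha) is that of t^m, m = m_f(a),
   and it equals f_gamma(c), gamma = gamma_f(a). If m = k this is the only condition,
   whence the P_k term. If m < k then c lies in X_gamma, and by non-degeneracy X_gamma is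
   the disjoint union of the pieces on which the first nonvanishing partial derivative of
   f_gamma is the i-th. There the coefficient of t^(m+j) is
   (d_i f_gamma)(c) alpha_(i,a_i+j) plus a term independent of alpha_(i,a_i+j'), j' >= j,
   so the coordinates alpha_(i,a_i+j), 1 <= j <= k - m, can be traded one by one for the
   coefficients of t^(m+j); whence the Q_k term. All identities are exact in K_0 after
   multiplication by L^(nN+k); only the negligible part needs the completion. *)

From HB Require Import structures.
Require Import Defs.
From mathcomp Require Import all_boot all_order all_algebra.
From mathcomp Require Import boolp classical_sets functions reals topology function_spaces.
From mathcomp Require Import Rstruct Rstruct_topology.
From mathcomp Require pseudometric_normed_Zmodule normed_module num_normedtype.
From mathcomp Require Import mpoly.
From mathcomp Require Import ring_quotient.
From mathcomp Require Import ring zify.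
From Stdlib Require List.

Set Implicit Arguments.
Unset Strict Implicit.
Unset Printing Implicit Defensive.

Import Order.TTheory GRing.Theory Num.Theory.
Import ArrowAsProduct.
Local Open Scope ring_scope.
Local Open Scope classical_set_scope.

(** * The Grothendieck group as a quotient *)

(** Only the additive group is formed as a quotient, [K0]; it gets no product. Products of formal
    sums are followed on sets instead: [represents] says that a formal sum behaves like a set T when
    multiplied by an arbitrary test set, and this property is stable under products and differences.
    Negative powers of L are cleared at one level J = N n + k: the exponents s(a) are at most N n,
    and the Q-terms add k - m_f(a), at most k. The factor L^k then appears as k idle coordinates
    next to those of the jet. Two facts make N >= k enough. The conditions involve only the
    coefficients up to t^k, and a nonzero i-th partial derivative of f_gamma forces a_i <= m_f(a),
    so that the traded coordinates, up to a_i + k - m_f(a), stay inside the N-jet. Non-degeneracy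
    speaks of compact faces only. Arcs start at 0, so all a_i are positive, and such weights expose
    compact faces; this has to be proved for [Gamma], an intersection of convex sets. *)

Definition relspan_pred : pred (gen -> int) := fun F =>
  `[< exists (m : nat) (z : 'I_m -> int) (r : 'I_m -> fsum0),
    (forall t, relgen (r t)) /\
    forall g, F g = \sum_(t < m) z t * coef (r t) g >].

Lemma relspan_zmod_closed : zmod_closed relspan_pred.
Proof.
split.
  apply/asboolP; exists 0%N, (fun=> 0), (fun=> [::]); split; first by case.
  by move=> g; rewrite big_ord0.
move=> F G /asboolP[m [z [r [hr hF]]]] /asboolP[m' [z' [r' [hr' hG]]]].
apply/asboolP; exists (m + m')%N.
exists (fun t => match fintype.split t with inl i => z i | inr i => - z' i end).
exists (fun t => match fintype.split t with inl i => r i | inr i => r' i end).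
split; first by move=> t; case: (fintype.split t).
move=> g; rewrite big_split_ord /= -[LHS]/(F g - G g) hF hG; congr (_ + _).
  by apply: eq_bigr => i _; rewrite (unsplitK (inl _ i)).
rewrite -sumrN; apply: eq_bigr => i _.
by rewrite (unsplitK (inr _ i)) mulNr.
Qed.

HB.instance Definition _ :=
  GRing.isZmodClosed.Build (gen -> int) relspan_pred relspan_zmod_closed.

Definition relspan := GRing.ZmodClosed.clone (gen -> int) relspan_pred _.

Definition K0 : zmodType := Quotient.quot relspan.

Definition gind (g : gen) : gen -> int := fun g' => if `[< g = g' >] then 1 else 0.

Definition gclass (g : gen) : K0 := (\pi_(Quotient.quot relspan))%qT (gind g).

Lemma mulrz_intfun (h : gen -> int) (z : int) (g : gen) : (h *~ z) g = z * h g.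
Proof.
have mn (n : nat) : (h *+ n) g = n%:Z * h g.
  elim: n => [|n ih]; first by rewrite mulr0n mul0r.
  by rewrite mulrS -[LHS]/(h g + (h *+ n) g) ih intS mulrDl mul1r.
case: z => n; first by rewrite -pmulrn mn.
by rewrite NegzE mulrNz -pmulrn -[LHS]/(- ((h *+ n.+1) g)) mn mulNr.
Qed.

Lemma coef_gind (x : fsum0) : coef x = \sum_(p <- x) gind p.2 *~ p.1.
Proof.
elim: x => [|p x ih]; first by rewrite big_nil; apply/funext=> g; rewrite /coef big_nil.
rewrite big_cons -ih; apply/funext => g.
rewrite /coef big_cons -[RHS]/((_ *~ _) g + coef x g); congr (_ + _).
by rewrite mulrz_intfun /gind; case: asboolP => _; rewrite ?mulr1 ?mulr0.
Qed.

Lemma pi_coef (x : fsum0) :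
  (\pi_(Quotient.quot relspan))%qT (coef x) = \sum_(p <- x) gclass p.2 *~ p.1.
Proof.
by rewrite coef_gind raddf_sum; apply: eq_bigr => p _; rewrite raddfMz.
Qed.

(** Turns the explicit combinations of relations in [K0zero] into an equation in an abelian group,
    where terms can be rewritten one by one. *)
Lemma K0zeroP (x : fsum0) : K0zero x <-> \sum_(p <- x) gclass p.2 *~ p.1 = 0.
Proof.
have e : K0zero x <-> coef x \in relspan.
  by split => [h|/asboolP//]; apply/asboolP.
rewrite e -pi_coef -{1}[coef x]subr0 Quotient.idealrBE -[0 in X in _ <-> X](raddf0 (\pi_(Quotient.quot relspan))%qT).
by split => /eqP.
Qed.

Lemma K0_rel (r : fsum0) : relgen r -> \sum_(p <- r) gclass p.2 *~ p.1 = 0.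
Proof.
move=> hr; apply/K0zeroP; exists 1%N, (fun=> 1), (fun=> r); split=> // g.
by rewrite big_ord1 mul1r.
Qed.

Lemma gclass_biso (g1 g2 : gen) :
  glclosed g1 -> glclosed g2 -> biso g1 g2 -> gclass g1 = gclass g2.
Proof.
move=> h1 h2 h; have /K0_rel : relgen [:: (1, g1); (-1, g2)].
  by left; exists g1, g2.
by rewrite !big_cons big_nil /= addr0 mulrNz mulr1z => /subr0_eq.
Qed.

Lemma gclass_scissor (N : nat) (X C : set ('I_N -> R)) : lclosed X -> zclosed C ->
  gclass (Gen X) = gclass (Gen (X `&` C)) + gclass (Gen (X `\` C)).
Proof.
move=> hX hC.
have /K0_rel : relgen [:: (1, Gen X); (-1, Gen (X `&` C)); (-1, Gen (X `\` C))].
  by right; exists N, X, C.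
by rewrite !big_cons big_nil /= addr0 !mulrNz !mulr1z -opprD => /subr0_eq.
Qed.

(** * Polynomial functions and locally closed sets *)

(** Coordinates are indexed by an arbitrary type, so that jets can be indexed by pairs and products
    of spaces by sum types; closure under substitution is then a single induction. *)
Inductive polyfun (I : Type) : ((I -> R) -> R) -> Prop :=
| polyfun_cst c : polyfun (fun=> c)
| polyfun_coord i : polyfun (fun x => x i)
| polyfunD p q : polyfun p -> polyfun q -> polyfun (fun x => p x + q x)
| polyfunM p q : polyfun p -> polyfun q -> polyfun (fun x => p x * q x).

Lemma polyfunB (I : Type) (p q : (I -> R) -> R) :
  polyfun p -> polyfun q -> polyfun (fun x => p x - q x).
Proof.
move=> hp hq; have -> : (fun x => p x - q x) = (fun x => p x + -1 * q x).
  by apply/funext => x; rewrite mulN1r.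
by apply: polyfunD => //; apply: polyfunM => //; apply: polyfun_cst.
Qed.

Lemma polyfun_sum (I : Type) (T : Type) (s : seq T) (P : pred T) (F : T -> (I -> R) -> R) :
  (forall t, polyfun (F t)) -> polyfun (fun x => \sum_(t <- s | P t) F t x).
Proof.
move=> h; elim: s => [|t s ih].
  have -> : (fun x => \sum_(t <- [::] | P t) F t x) = (fun=> 0).
    by apply/funext=> x; rewrite big_nil.
  exact: polyfun_cst.
have -> : (fun x => \sum_(t <- t :: s | P t) F t x) =
    (fun x => (if P t then F t x else 0) + \sum_(t <- s | P t) F t x).
  by apply/funext=> x; rewrite big_cons; case: (P t); rewrite ?add0r.
by apply: polyfunD => //; case: (P t) => //; apply: polyfun_cst.
Qed.

Lemma polyfun_prod (I : Type) (T : Type) (s : seq T) (P : pred T) (F : T -> (I -> R) -> R) :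
  (forall t, polyfun (F t)) -> polyfun (fun x => \prod_(t <- s | P t) F t x).
Proof.
move=> h; elim: s => [|t s ih].
  have -> : (fun x => \prod_(t <- [::] | P t) F t x) = (fun=> 1).
    by apply/funext=> x; rewrite big_nil.
  exact: polyfun_cst.
have -> : (fun x => \prod_(t <- t :: s | P t) F t x) =
    (fun x => (if P t then F t x else 1) * \prod_(t <- s | P t) F t x).
  by apply/funext=> x; rewrite big_cons; case: (P t); rewrite ?mul1r.
by apply: polyfunM => //; case: (P t) => //; apply: polyfun_cst.
Qed.

Lemma polyfunX (I : Type) (p : (I -> R) -> R) (e : nat) :
  polyfun p -> polyfun (fun x => p x ^+ e).
Proof.
move=> hp; elim: e => [|e ih]; first exact: polyfun_cst.
have -> : (fun x => p x ^+ e.+1) = (fun x => p x * p x ^+ e).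
  by apply/funext=> x; rewrite exprS.
exact: polyfunM.
Qed.

Lemma polyfun_comp (I J : Type) (phi : (I -> R) -> J -> R) (p : (J -> R) -> R) :
  (forall j, polyfun (fun x => phi x j)) -> polyfun p -> polyfun (fun x => p (phi x)).
Proof.
move=> h; elim=> [c|i|q r _ hq _ hr|q r _ hq _ hr].
- exact: polyfun_cst.
- exact: h.
- exact: polyfunD.
- exact: polyfunM.
Qed.

Lemma polyfun_reindex (I J : Type) (g : J -> I) (p : (J -> R) -> R) :
  polyfun p -> polyfun (fun x => p (fun j => x (g j))).
Proof.
exact: (@polyfun_comp _ _ (fun x j => x (g j)) _ (fun j => polyfun_coord (g j))).
Qed.

Lemma polyfun_ev (N : nat) (P : {mpoly R[N]}) : polyfun (ev P).
Proof.
have -> : ev P = (fun x => \sum_(m <- msupp P) P@_m * \prod_i x i ^+ m i).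
  by apply/funext=> x; rewrite /ev mevalE.
apply: polyfun_sum => m; apply: polyfunM; first exact: polyfun_cst.
by apply: polyfun_prod => i; apply/polyfunX/polyfun_coord.
Qed.

Lemma polyfun_mpoly (N : nat) (p : ('I_N -> R) -> R) :
  polyfun p -> exists P : {mpoly R[N]}, p = ev P.
Proof.
elim=> [c|i|q r _ [P ->] _ [Q ->]|q r _ [P ->] _ [Q ->]].
- by exists c%:MP; apply/funext => x; rewrite /ev mevalC.
- by exists 'X_i; apply/funext => x; rewrite /ev mevalXU.
- by exists (P + Q); apply/funext => x; rewrite /ev mevalD.
- by exists (P * Q); apply/funext => x; rewrite /ev mevalM.
Qed.

Definition zset (I : Type) (C : set (I -> R)) : Prop :=
  exists2 p, polyfun p & C = [set x | p x = 0].

Definition lcset (I : Type) (X : set (I -> R)) : Prop :=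
  exists2 pq, polyfun pq.1 /\ polyfun pq.2 & X = [set x | pq.1 x = 0 /\ pq.2 x != 0].

(** Over the reals a finite system of equations is the single equation that the sum of the squares
    vanishes. *)
Lemma zclosedP (N : nat) (C : set ('I_N -> R)) : zclosed C <-> zset C.
Proof.
split=> [[s ->]|[p hp ->]]; last first.
  have [P ->] := polyfun_mpoly hp; exists [:: P].
  by apply/seteqP; split=> x /=; rewrite andbT => /eqP.
exists (fun x => \sum_(P <- s) ev P x ^+ 2).
  by apply: polyfun_sum => P; apply/polyfunX/polyfun_ev.
apply/seteqP; split=> x /=.
  by move=> /allP h; rewrite big_seq big1 // => P /h /eqP ->; rewrite expr0n.
move/eqP; rewrite psumr_eq0 => [/allP h|P _]; last exact: sqr_ge0.
by apply/allP => P /h /=; rewrite sqrf_eq0.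
Qed.

Lemma lclosedP (N : nat) (X : set ('I_N -> R)) : lclosed X <-> lcset X.
Proof.
split.
  move=> [C [D [/zclosedP[p hp ->] [/zclosedP[q hq ->] ->]]]].
  exists (p, q) => //; apply/seteqP; split => x /= [h1 h2]; split=> //; exact/eqP.
move=> [[p q] /= [hp hq] ->]; exists [set x | p x = 0], [set x | q x = 0].
split; first by apply/zclosedP; exists p.
split; first by apply/zclosedP; exists q.
by apply/seteqP; split => x /= [h1 h2]; split=> //; apply/eqP.
Qed.

Lemma lcset_eq0 (I : Type) (p : (I -> R) -> R) : polyfun p -> lcset [set x | p x = 0].
Proof.
move=> hp; exists (p, fun=> 1); first by split=> //; apply: polyfun_cst.
by apply/seteqP; split=> x /= => [->|[]//]; rewrite oner_neq0.
Qed.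

Lemma lcset_neq0 (I : Type) (p : (I -> R) -> R) : polyfun p -> lcset [set x | p x != 0].
Proof.
move=> hp; exists (fun=> 0, p); first by split=> //; apply: polyfun_cst.
by apply/seteqP; split=> x /= => [->|[]//].
Qed.

Lemma lcsetT (I : Type) : lcset [set: I -> R].
Proof.
have -> : [set: I -> R] = [set x | (fun=> 0 : R) x = 0] by apply/seteqP; split.
exact: (@lcset_eq0 I (fun=> 0) (polyfun_cst _ 0)).
Qed.

Lemma lcset0 (I : Type) : lcset (set0 : set (I -> R)).
Proof.
have -> : (set0 : set (I -> R)) = [set x | (fun=> 1 : R) x = 0].
  by apply/seteqP; split=> // x /= /eqP; rewrite oner_eq0.
exact: (@lcset_eq0 I (fun=> 1) (polyfun_cst _ 1)).
Qed.

Lemma lcsetI (I : Type) (X Y : set (I -> R)) : lcset X -> lcset Y -> lcset (X `&` Y).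
Proof.
move=> [[p q] /= [hp hq] ->] [[p' q'] /= [hp' hq'] ->].
exists (fun x => p x ^+ 2 + p' x ^+ 2, fun x => q x * q' x).
  by split; [apply: polyfunD; apply: polyfunX | apply: polyfunM].
apply/seteqP; split=> x /=.
  by move=> [[-> ?] [-> ?]]; rewrite expr0n addr0 mulf_neq0.
rewrite mulf_eq0 negb_or => -[/eqP]; rewrite paddr_eq0 ?sqr_ge0 // !sqrf_eq0.
by move=> /andP[/eqP-> /eqP->] /andP[].
Qed.

Lemma zset_lc (I : Type) (C : set (I -> R)) : zset C -> lcset C.
Proof. by move=> [p hp ->]; apply: lcset_eq0. Qed.

Lemma zsetC_lc (I : Type) (C : set (I -> R)) : zset C -> lcset (~` C).
Proof.
move=> [p hp ->]; have -> : ~` [set x | p x = 0] = [set x | p x != 0].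
  by apply/seteqP; split=> x /= /eqP.
exact: lcset_neq0.
Qed.

Lemma lcset_preim (I J : Type) (phi : (I -> R) -> J -> R) (X : set (J -> R)) :
  (forall j, polyfun (fun x => phi x j)) -> lcset X -> lcset (phi @^-1` X).
Proof.
move=> h [[p q] /= [hp hq] ->].
by exists (fun x => p (phi x), fun x => q (phi x)) => //; split; apply: polyfun_comp.
Qed.

Lemma lcset_reindex (I J : Type) (g : J -> I) (X : set (J -> R)) :
  lcset X -> lcset [set x | X (fun j => x (g j))].
Proof. exact: (@lcset_preim _ _ (fun x j => x (g j)) _ (fun j => polyfun_coord (g j))). Qed.

Lemma lcset_forall (I : Type) (T : Type) (s : seq T) (F : T -> set (I -> R)) :
  (forall t, lcset (F t)) -> lcset [set x | List.Forall (F^~ x) s].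
Proof.
move=> h; elim: s => [|t s ih].
  by rewrite (_ : [set x | _] = setT); [apply: lcsetT | apply/seteqP; split=> x //= _].
rewrite (_ : [set x | _] = F t `&` [set x | List.Forall (F^~ x) s]); first exact: lcsetI.
apply/seteqP; split=> x /=; first by move=> h'; inversion h'.
by case=> *; constructor.
Qed.

Lemma lcset_all (I : Type) (T : finType) (F : T -> set (I -> R)) :
  (forall t, lcset (F t)) -> lcset [set x | forall t, F t x].
Proof.
move=> /(lcset_forall (enum T)).
rewrite (_ : [set x | List.Forall _ _] = [set x | forall t, F t x]) //.
apply/seteqP; split=> x /=; last by move=> h; elim: (enum T) => [|t s ih]; constructor.
move=> h t; have : t \in enum T by rewrite mem_enum.
elim: h => [|u s hu hs ih]; first by rewrite in_nil.
by rewrite in_cons => /orP[/eqP->|/ih].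
Qed.

(** * Isomorphisms and scissor relations for sets with coordinates in a finite type *)

Definition ratfun (I : Type) (X : set (I -> R)) (h : (I -> R) -> R) : Prop :=
  exists p q, [/\ polyfun p, polyfun q & forall x, X x -> q x != 0 /\ h x = p x / q x].

Lemma ratfun_poly (I : Type) (X : set (I -> R)) (h : (I -> R) -> R) :
  polyfun h -> ratfun X h.
Proof.
move=> hh; exists h, (fun=> 1); split=> //; first exact: polyfun_cst.
by move=> x _; rewrite oner_neq0 divr1.
Qed.

Lemma gclass_iso (N M : nat) (X : set ('I_N -> R)) (Y : set ('I_M -> R)) phi psi :
  lcset X -> lcset Y ->
  (forall j, ratfun X (fun x => phi x j)) -> (forall i, ratfun Y (fun y => psi y i)) ->
  (forall x, X x -> Y (phi x) /\ psi (phi x) = x) ->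
  (forall y, Y y -> X (psi y) /\ phi (psi y) = y) ->
  gclass (Gen X) = gclass (Gen Y).
Proof.
move=> hX hY hphi hpsi h1 h2.
apply: gclass_biso; rewrite /glclosed ?lclosedP //.
exists phi, psi; split; last split=> //.
  move=> j; have [p [q [hp hq hh]]] := hphi j.
  have [P eP] := polyfun_mpoly hp; have [Q eQ] := polyfun_mpoly hq.
  by exists P, Q; rewrite -eP -eQ.
move=> j; have [p [q [hp hq hh]]] := hpsi j.
have [P eP] := polyfun_mpoly hp; have [Q eQ] := polyfun_mpoly hq.
by exists P, Q; rewrite -eP -eQ.
Qed.

(** The coordinates are numbered by [enum_rank] because [gen] wants ordinals; [cl_reindex] shows
    that the numbering is irrelevant. *)
Definition cl (I : finType) (X : set (I -> R)) : K0 :=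
  gclass (@Gen #|I| [set v | X (fun i => v (enum_rank i))]).

Lemma cl_iso (I J : finType) (X : set (I -> R)) (Y : set (J -> R)) phi psi :
  lcset X -> lcset Y ->
  (forall j, ratfun X (fun x => phi x j)) -> (forall i, ratfun Y (fun y => psi y i)) ->
  (forall x, X x -> Y (phi x) /\ psi (phi x) = x) ->
  (forall y, Y y -> X (psi y) /\ phi (psi y) = y) ->
  cl X = cl Y.
Proof.
move=> hX hY hphi hpsi h1 h2.
apply: (@gclass_iso _ _ _ _
  (fun v j => phi (fun i => v (enum_rank i)) (enum_val j))
  (fun w i => psi (fun j => w (enum_rank j)) (enum_val i))).
- exact: lcset_reindex.
- exact: lcset_reindex.
- move=> j; have [p [q [hp hq hh]]] := hphi (enum_val j).
  exists (fun v => p (fun i => v (enum_rank i))), (fun v => q (fun i => v (enum_rank i))).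
  by split; [apply: polyfun_reindex|apply: polyfun_reindex|move=> v /hh].
- move=> j; have [p [q [hp hq hh]]] := hpsi (enum_val j).
  exists (fun v => p (fun i => v (enum_rank i))), (fun v => q (fun i => v (enum_rank i))).
  by split; [apply: polyfun_reindex|apply: polyfun_reindex|move=> v /hh].
- move=> v /= /h1[hv e].
  have -> : (fun j => phi (fun i => v (enum_rank i)) (enum_val (enum_rank j))) =
            phi (fun i => v (enum_rank i)).
    by apply/funext=> j; rewrite enum_rankK.
  by rewrite e; split=> //; apply/funext => i; rewrite enum_valK.
- move=> v /= /h2[hv e].
  have -> : (fun j => psi (fun i => v (enum_rank i)) (enum_val (enum_rank j))) =
            psi (fun i => v (enum_rank i)).
    by apply/funext=> j; rewrite enum_rankK.
  by rewrite e; split=> //; apply/funext => i; rewrite enum_valK.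
Qed.

Lemma cl_reindex (I J : finType) (X : set (I -> R)) (g : I -> J) :
  bijective g -> lcset X -> cl X = cl [set y : J -> R | X (fun i => y (g i))].
Proof.
move=> [g' gK g'K] hX.
apply: (@cl_iso _ _ _ _ (fun x j => x (g' j)) (fun y i => y (g i))) => //.
- exact: lcset_reindex.
- by move=> j; apply/ratfun_poly/polyfun_coord.
- by move=> j; apply/ratfun_poly/polyfun_coord.
- move=> x hx; have e : (fun i => x (g' (g i))) = x by apply/funext=> i; rewrite gK.
  by rewrite /= e.
- by move=> y /= hy; split=> //; apply/funext=> j; rewrite g'K.
Qed.

Lemma gclass_cl (N : nat) (X : set ('I_N -> R)) : lcset X -> gclass (Gen X) = cl X.
Proof.
move=> hX; apply: (@gclass_iso _ _ _ _ (fun x j => x (enum_val j)) (fun y i => y (enum_rank i))).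
- by [].
- exact: lcset_reindex.
- by move=> j; apply/ratfun_poly/polyfun_coord.
- by move=> j; apply/ratfun_poly/polyfun_coord.
- move=> x hx; have e : (fun i => x (enum_val (enum_rank i))) = x.
    by apply/funext=> i; rewrite enum_rankK.
  by rewrite /= e.
- by move=> y /= hy; split=> //; apply/funext=> j; rewrite enum_valK.
Qed.

Lemma cl_scissor (I : finType) (X C : set (I -> R)) : lcset X -> zset C ->
  cl X = cl (X `&` C) + cl (X `\` C).
Proof.
move=> hX hC; rewrite /cl.
rewrite (@gclass_scissor _ _ [set v | C (fun i => v (enum_rank i))]) //.
  by apply/lclosedP; apply: lcset_reindex.
apply/zclosedP; case: hC => p hp ->.
by exists (fun v => p (fun i => v (enum_rank i))) => //; apply: polyfun_reindex.
Qed.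

(** Cutting the empty set along the whole space shows that its class is twice itself. *)
Lemma cl0 (I : finType) : cl (set0 : set (I -> R)) = 0.
Proof.
have hT : zset [set: I -> R].
  by exists (fun=> 0); [apply: polyfun_cst | apply/seteqP; split].
have := cl_scissor (lcset0 I) hT.
rewrite setIT setDT -[X in X = _]addr0 => /addrI. by [].
Qed.

(* Finite disjoint unions: cut along the closed set C1 and then the closed set D1
   of a presentation C1 \ D1 of the first piece; every other piece meets C1 only
   inside D1. *)
Lemma cl_seq_partition (I : finType) (T : eqType) (s : seq T) (X : set (I -> R))
    (Y : T -> set (I -> R)) :
  uniq s -> lcset X -> (forall t, lcset (Y t)) ->
  (forall x, X x <-> exists2 t, t \in s & Y t x) ->
  (forall t t' x, Y t x -> Y t' x -> t = t') ->
  cl X = \sum_(t <- s) cl (Y t).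
Proof.
elim: s X Y => [|t s ih] X Y.
  move=> _ _ _ h _; rewrite big_nil -[RHS](cl0 I); congr cl.
  by apply/seteqP; split=> // x /h[].
move=> /= /andP[nts us] hX hY h hd; rewrite big_cons.
case: (hY t) => -[p q] /= [hp hq] eYt.
pose C := [set x | p x = 0]; pose D := [set x | q x = 0].
have zC : zset C by exists p.
have zD : zset D by exists q.
have tsE u : u \in s -> u <> t by move=> us' e; rewrite -e us' in nts.
rewrite (cl_scissor hX zC) (cl_scissor (lcsetI hX (zset_lc zC)) zD).
rewrite (_ : (X `&` C) `\` D = Y t); last first.
  rewrite eYt; apply/seteqP; split=> x /=.
    by move=> [[_ hx] /eqP].
  move=> hx; split; last by apply/eqP; case: hx.
  by split; [apply/h; exists t; rewrite ?mem_head // eYt | case: hx].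
rewrite [X in X + _]addrC -addrA; congr (_ + _).
have lcXD Z : lcset Z -> lcset (Z `&` C `&` D).
  by move=> hZ; apply: lcsetI (zset_lc zD); apply: lcsetI (zset_lc zC).
have lcXC Z : lcset Z -> lcset (Z `\` C).
  by move=> hZ; rewrite setDE; apply: lcsetI => //; apply: zsetC_lc.
(* Induction applies to both remainders, inside C and D and outside C, with every other piece cut in
   the same way; the two sums are then glued back term by term. *)
rewrite (ih (X `&` C `&` D) (fun u => Y u `&` C `&` D)) //; last 4 first.
- by apply: lcXD.
- move=> u; exact: lcXD.
- move=> x; split.
    move=> [[/h[u]]]; rewrite in_cons => /orP[/eqP->|us'] hu hC hD.
      by move: hu hD; rewrite eYt => -[_ /eqP].
    by exists u.
  move=> [u us' [[hu hC] hD]]; split=> //; split=> //; apply/h; exists u => //.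
  by rewrite in_cons us' orbT.
- by move=> u u' x [[h1 _] _] [[h2 _] _]; apply: hd h1 h2.
rewrite (ih (X `\` C) (fun u => Y u `\` C)) //; last 4 first.
- exact: lcXC.
- move=> u; exact: lcXC.
- move=> x; split.
    move=> [/h[u]]; rewrite in_cons => /orP[/eqP->|us'] hu hC.
      by move: hu; rewrite eYt => -[].
    by exists u.
  move=> [u us' [hu hC]]; split=> //; apply/h; exists u => //.
  by rewrite in_cons us' orbT.
- by move=> u u' x [h1 _] [h2 _]; apply: hd h1 h2.
rewrite -big_split /= big_seq [RHS]big_seq; apply: eq_bigr => u us'.
rewrite (cl_scissor (hY u) zC); congr (cl _ + _).
apply/seteqP; split=> x; first by case.
move=> [hu hC]; split; first by split.
have [hq0|/eqP hq'] := pselect (q x = 0); first exact: hq0.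
have hp' : p x = 0 by [].
by case: (tsE _ us'); apply: (hd _ _ x) => //; rewrite eYt /=.
Qed.

Lemma cl_partition (I T : finType) (X : set (I -> R)) (Y : T -> set (I -> R)) :
  lcset X -> (forall t, lcset (Y t)) ->
  (forall x, X x <-> exists t, Y t x) ->
  (forall t t' x, Y t x -> Y t' x -> t = t') ->
  cl X = \sum_t cl (Y t).
Proof.
move=> hX hY h hd; rewrite (@cl_seq_partition _ _ (enum T) X Y) ?enum_uniq //.
  by rewrite -big_enum.
move=> x; rewrite h; split=> [[t ht]|[t _ ht]]; exists t => //.
by rewrite mem_enum.
Qed.

(** * Products and formal sums *)

Definition prodset (I J : Type) (X : set (I -> R)) (Y : set (J -> R)) : set (I + J -> R) :=
  [set z | X (fun i => z (inl i)) /\ Y (fun j => z (inr j))].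

Lemma lcset_prod (I J : Type) (X : set (I -> R)) (Y : set (J -> R)) :
  lcset X -> lcset Y -> lcset (prodset X Y).
Proof.
move=> hX hY; exact: lcsetI (lcset_reindex inl hX) (lcset_reindex inr hY).
Qed.

Lemma gprod_reindex (g1 g2 : gen) (K : finType) (W : set (K -> R)) :
  glclosed g1 -> glclosed g2 -> lcset W ->
  cl (prodset (gset (gprod g1 g2)) W) = cl (prodset (gset g1) (prodset (gset g2) W)).
Proof.
move=> /lclosedP h1 /lclosedP h2 hW.
have hg : lcset (gset (gprod g1 g2)).
  exact: lcsetI (lcset_reindex (lshift (gdim g2)) h1) (lcset_reindex (@rshift (gdim g1) (gdim g2)) h2).
pose g (u : 'I_(gdim g1 + gdim g2) + K) : 'I_(gdim g1) + ('I_(gdim g2) + K) :=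
  match u with
  | inl i => match fintype.split i with inl j => inl j | inr j => inr (inl j) end
  | inr k => inr (inr k) end.
pose g' (u : 'I_(gdim g1) + ('I_(gdim g2) + K)) : 'I_(gdim g1 + gdim g2) + K :=
  match u with
  | inl i => inl (lshift _ i) | inr (inl j) => inl (rshift _ j) | inr (inr k) => inr k end.
have gK : bijective g.
  exists g'.
    move=> [i|k] //=; rewrite /g /g'.
    by rewrite -[i in RHS]splitK; case: (fintype.split i).
  move=> [i|[j|k]] //=; rewrite /g /g'.
    by rewrite (unsplitK (inl _ i)).
  by rewrite (unsplitK (inr _ j)).
rewrite (cl_reindex gK) //; last exact: lcset_prod.
congr cl; apply/seteqP.
have el z : (fun j => z (g (inl (lshift (gdim g2) j)))) = (fun j => z (inl j)) :> (_ -> R).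
  by apply/funext=> j; rewrite /g (unsplitK (inl _ j)).
have er z : (fun j => z (g (inl (rshift (gdim g1) j)))) = (fun j => z (inr (inl j))) :> (_ -> R).
  by apply/funext=> j; rewrite /g (unsplitK (inr _ j)).
by split=> z; rewrite /prodset /= el er; tauto.
Qed.

Lemma gset_lc (g : gen) : glclosed g -> lcset (gset g).
Proof. by move/lclosedP. Qed.

Lemma gprod_cl (g1 g2 : gen) : glclosed g1 -> glclosed g2 ->
  gclass (gprod g1 g2) = cl (prodset (gset g1) (gset g2)).
Proof.
move=> h1 h2.
have hg : lcset (gset (gprod g1 g2)).
  exact: lcsetI (lcset_reindex (lshift (gdim g2)) (gset_lc h1))
    (lcset_reindex (@rshift (gdim g1) (gdim g2)) (gset_lc h2)).
rewrite (gclass_cl hg) (@cl_reindex _ _ _ (@fintype.split _ _)) //; last first.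
  by exists (@unsplit _ _); [apply: splitK|apply: unsplitK].
congr cl; rewrite /gprod /prodset /=.
by apply/seteqP; split=> z /= [hz1 hz2]; split; [move: hz1|move: hz2|move: hz1|move: hz2];
  congr (gset _ _); apply/funext => j; rewrite ?(unsplitK (inl _ j)) ?(unsplitK (inr _ j)).
Qed.

Lemma cl_prodCA (I J K : finType) (X : set (I -> R)) (Y : set (J -> R)) (W : set (K -> R)) :
  lcset X -> lcset Y -> lcset W ->
  cl (prodset X (prodset Y W)) = cl (prodset Y (prodset X W)).
Proof.
move=> hX hY hW.
pose g (A B C : Type) (u : A + (B + C)) : B + (A + C) :=
  match u with inl a => inr (inl a) | inr (inl b) => inl b | inr (inr c) => inr (inr c) end.
rewrite (@cl_reindex _ _ _ (g I J K)).
- by congr cl; apply/seteqP; split=> z; rewrite /prodset /=; tauto.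
- by exists (g J I K); [case=> [|[]]|case=> [|[]]].
- by do 2?apply: lcset_prod.
Qed.

Lemma cl_prodA (I J K : finType) (X : set (I -> R)) (Y : set (J -> R)) (W : set (K -> R)) :
  lcset X -> lcset Y -> lcset W ->
  cl (prodset X (prodset Y W)) = cl (prodset (prodset X Y) W).
Proof.
move=> hX hY hW.
pose g (u : I + (J + K)) : I + J + K :=
  match u with inl a => inl (inl a) | inr (inl b) => inl (inr b) | inr (inr c) => inr c end.
pose g' (u : I + J + K) : I + (J + K) :=
  match u with inl (inl a) => inl a | inl (inr b) => inr (inl b) | inr c => inr (inr c) end.
rewrite (@cl_reindex _ _ _ g).
- by congr cl; apply/seteqP; split=> z; rewrite /prodset /=; tauto.
- by exists g'; [case=> [|[]]|case=> [[]|]].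
- by do 2?apply: lcset_prod.
Qed.

Lemma glclosed_gprod (g1 g2 : gen) : glclosed g1 -> glclosed g2 -> glclosed (gprod g1 g2).
Proof.
move=> h1 h2; apply/lclosedP.
exact: lcsetI (lcset_reindex (lshift (gdim g2)) (gset_lc h1))
    (lcset_reindex (@rshift (gdim g1) (gdim g2)) (gset_lc h2)).
Qed.

Lemma glclosed_affine (d : nat) : glclosed (affine d).
Proof. by apply/lclosedP; apply: lcsetT. Qed.

(* The value of x L^J in K_0; meaningful when every exponent occurring in x is at most J,
   the subtraction being truncated. *)
Definition valL (J : nat) (x : fsum) : K0 :=
  \sum_(p <- x) gclass (gprod p.2 (affine (J - p.1.2))) *~ p.1.1.

Lemma Lzero_valL (J : nat) (x : fsum) :
  all (fun p => (p.1.2 <= J)%N) x -> valL J x = 0 -> Lzero x.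
Proof.
move=> h1 h2; exists J; split=> //; apply/K0zeroP.
by rewrite big_map.
Qed.

Lemma valL_cat (J : nat) (x y : fsum) : valL J (x ++ y) = valL J x + valL J y.
Proof. by rewrite /valL big_cat. Qed.

Lemma valL_opp (J : nat) (x : fsum) : valL J (fopp x) = - valL J x.
Proof. by rewrite /valL big_map -sumrN; apply: eq_bigr => p _; rewrite mulrNz. Qed.

Lemma valL_sub (J : nat) (x y : fsum) : valL J (fsub x y) = valL J x - valL J y.
Proof. by rewrite valL_cat valL_opp. Qed.

Lemma valL_flatten (J : nat) (T : Type) (s : seq T) (F : T -> fsum) :
  valL J (flatten [seq F t | t <- s]) = \sum_(t <- s) valL J (F t).
Proof.
elim: s => [|t s ih] /=; first by rewrite /valL !big_nil.
by rewrite valL_cat ih big_cons.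
Qed.

Lemma valL_mul_cat (J : nat) (x y z : fsum) :
  valL J (fmul x (y ++ z)) = valL J (fmul x y) + valL J (fmul x z).
Proof.
rewrite /valL /fmul !big_allpairs_dep -big_split /=.
by apply: eq_bigr => p _; rewrite big_cat.
Qed.

Lemma valL_mul0 (J : nat) (x : fsum) : valL J (fmul x [::]) = 0.
Proof. by rewrite /valL /fmul big_allpairs_dep big1 // => p _; rewrite big_nil. Qed.

Lemma valL_mul_flatten (J : nat) (T : Type) (x : fsum) (s : seq T) (F : T -> fsum) :
  valL J (fmul x (flatten [seq F t | t <- s])) = \sum_(t <- s) valL J (fmul x (F t)).
Proof.
elim: s => [|t s ih] /=; first by rewrite big_nil valL_mul0.
by rewrite valL_mul_cat ih big_cons.
Qed.

(** The formal sum times the test set [W]. The exponents of L are left out: in [represents] they are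
    all equal to [e]. *)
Definition vsum (x : fsum) (K : finType) (W : set (K -> R)) : K0 :=
  \sum_(p <- x) cl (prodset (gset p.2) W) *~ p.1.1.

(* x represents [T] L^(-e), compatibly with products by any variety W *)
Definition represents (e : nat) (x : fsum) (I : finType) (T : set (I -> R)) : Prop :=
  [/\ forall p, List.In p x -> glclosed p.2 /\ p.1.2 = e, lcset T
    & forall (K : finType) (W : set (K -> R)), lcset W -> vsum x W = cl (prodset T W)].

Lemma eq_big_In (V : nmodType) (T : Type) (s : seq T) (F G : T -> V) :
  (forall t, List.In t s -> F t = G t) -> \sum_(t <- s) F t = \sum_(t <- s) G t.
Proof.
elim: s => [|t s ih] h; first by rewrite !big_nil.
by rewrite !big_cons h ?ih //=; [move=> u hu; apply: h; right|left].
Qed.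

Lemma represents_valL (e J : nat) (x : fsum) (I : finType) (T : set (I -> R)) :
  represents e x T -> valL J x = cl (prodset T [set: 'I_(J - e) -> R]).
Proof.
move=> [h1 h2 h3]; rewrite -h3; last exact: lcsetT.
apply: eq_big_In => p /h1[hp ->].
by rewrite gprod_cl //; apply: glclosed_affine.
Qed.

Lemma represents_cls (g : gen) : glclosed g -> represents 0 (cls g) (gset g).
Proof.
move=> hg; split; last by move=> K W _; rewrite /vsum big_seq1.
  by move=> p [<-|//].
exact: gset_lc.
Qed.

Lemma represents_Lneg (e : nat) : represents e (Lneg e) [set: 'I_0 -> R].
Proof.
split; last by move=> K W _; rewrite /vsum big_seq1.
  by move=> p [<-|//]; split=> //; apply: glclosed_affine.
exact: lcsetT.
Qed.

Lemma represents_reindex (e : nat) (x : fsum) (I J : finType) (T : set (I -> R)) (g : I -> J) :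
  bijective g -> represents e x T -> represents e x [set y : J -> R | T (fun i => y (g i))].
Proof.
move=> [g' gK g'K] [h1 h2 h3]; split=> //; first exact: lcset_reindex.
move=> K W hW; rewrite h3 //.
rewrite (@cl_reindex _ _ _ (fun u : I + K => match u with inl i => inl (g i) | inr k => inr k end)) //.
  exists (fun u : J + K => match u with inl i => inl (g' i) | inr k => inr k end).
    by case=> // i; rewrite gK.
  by case=> // i; rewrite g'K.
exact: lcset_prod.
Qed.

(** This is what the test sets are for. Each term of [y] times [W] is a test set for [x], which
    replaces [x] by [T]; then [T] times [W] is a test set for [y]. *)
Lemma represents_mul (e e' : nat) (x y : fsum) (I I' : finType)
    (T : set (I -> R)) (T' : set (I' -> R)) :
  represents e x T -> represents e' y T' -> represents (e + e') (fmul x y) (prodset T T').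
Proof.
move=> [h1 h2 h3] [h1' h2' h3']; split; last 1 first.
- move=> K W hW; rewrite /vsum /fmul big_allpairs_dep exchange_big /=.
  transitivity (vsum y (prodset T W)); last first.
    rewrite h3'; last exact: lcset_prod.
    by rewrite cl_prodCA // cl_prodA.
  apply: eq_big_In => q /h1'[hq _].
  rewrite cl_prodCA //; last exact: gset_lc.
  rewrite -h3; last by apply: lcset_prod => //; apply: gset_lc.
  rewrite /vsum mulrz_suml; apply: eq_big_In => p /h1[hp _].
  by rewrite gprod_reindex // mulrzA.
- move=> r.
  rewrite /fmul; elim: x h1 {h3} => [|p x ih] h1 //=.
  move=> /List.in_app_iff[|]; last by apply: ih => q hq; apply: h1; right.
  elim: y h1' {ih h3'} => [|q y ih'] h1' //= [<-|]; last first.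
    by apply: ih' => s hs; apply: h1'; right.
  have [hp ep] := h1 _ (or_introl erefl); have [hq eq] := h1' _ (or_introl erefl).
  by rewrite /= ep eq; split=> //; apply: glclosed_gprod.
- exact: lcset_prod.
Qed.

Lemma represents_mulL (e : nat) (x : fsum) (I : finType) (T : set (I -> R)) :
  represents 0 x T -> represents e (fmul x (Lneg e)) T.
Proof.
move=> h; have := represents_mul h (represents_Lneg e).
pose g (u : I + 'I_0) : I := match u with inl i => i | inr j => match notF (ltn_ord j) with end end.
have gK : bijective g by exists inl; [case=> // -[]|].
move/(represents_reindex gK); rewrite /prodset /=.
rewrite (_ : [set y | _] = T) //.
by apply/seteqP; split=> y /=; tauto.
Qed.

(** The scissor relation along the cylinder over [U], in the product with the test set. *)
Lemma represents_sub (e : nat) (x y : fsum) (I : finType) (T U : set (I -> R)) :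
  represents e x T -> represents e y (T `&` U) -> zset U -> represents e (fsub x y) (T `\` U).
Proof.
move=> [h1 h2 h3] [h1' h2' h3'] zU; split.
- move=> p /List.in_app_iff[/h1//|]; rewrite /fopp => /List.in_map_iff[q [<-]].
  by move/h1'.
- by rewrite setDE; apply: lcsetI => //; apply: zsetC_lc.
move=> K W hW.
have -> : vsum (fsub x y) W = vsum x W - vsum y W.
  rewrite /vsum big_cat big_map -sumrN; congr (_ + _).
  by apply: eq_bigr => p _; rewrite mulrNz.
rewrite h3 // h3' //.
have zC : zset [set z : I + K -> R | U (fun i => z (inl i))].
  by case: zU => p hp ->; exists (fun z => p (fun i => z (inl i))); first exact: polyfun_reindex.
rewrite (cl_scissor (lcset_prod h2 hW) zC).
rewrite (_ : prodset T W `&` _ = prodset (T `&` U) W); last first.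
  by apply/seteqP; split=> z; rewrite /prodset /=; tauto.
rewrite addrC addKr; congr cl.
by apply/seteqP; split=> z; rewrite /prodset /=; tauto.
Qed.

(** * Sets represented by L - 1 and its powers *)

Definition torus (n : nat) : set ('I_n -> R) := [set c | forall i, c i != 0].
Arguments torus : clear implicits.

Lemma lcset_torus (n : nat) : lcset (torus n).
Proof.
apply: (@lcset_all _ _ (fun i => [set c : 'I_n -> R | c i != 0])) => i.
exact: (@lcset_neq0 _ (fun c => c i) (polyfun_coord i)).
Qed.

Lemma cl_prod0 (K : finType) (W : set (K -> R)) : lcset W ->
  cl (prodset [set: 'I_0 -> R] W) = cl W.
Proof.
move=> hW; pose g (u : 'I_0 + K) : K :=
  match u with inl j => match notF (ltn_ord j) with end | inr k => k end.
have gK : bijective g by exists inr; [case=> // -[]|].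
rewrite (cl_reindex gK); last by apply: lcset_prod => //; apply: lcsetT.
by congr cl; apply/seteqP; split=> z; rewrite /prodset /=; tauto.
Qed.

Lemma cl_prod_point (s : R) (K : finType) (W : set (K -> R)) : lcset W ->
  cl (prodset [set c : 'I_1 -> R | c ord0 = s] W) = cl W.
Proof.
move=> hW; have h1 : lcset [set c : 'I_1 -> R | c ord0 = s].
  rewrite (_ : [set c | _] = [set c | c ord0 - s = 0]).
    by apply: lcset_eq0; apply: polyfunB; [apply: polyfun_coord|apply: polyfun_cst].
  by apply/seteqP; split=> c /= => [->|/eqP]; rewrite ?subrr // subr_eq0 => /eqP.
apply: (@cl_iso _ _ _ _ (fun x k => x (inr k))
  (fun y u => match u with inl _ => s | inr k => y k end)) => //.
- exact: lcset_prod.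
- by move=> k; apply/ratfun_poly/polyfun_coord.
- by move=> [i|k]; apply: ratfun_poly; [apply: polyfun_cst|apply: polyfun_coord].
by move=> x [hx hW']; split=> //; apply/funext => -[i|k] //; rewrite ord1 -hx.
Qed.

Lemma represents_punctured_line : represents 0 (fsub fL fone) (torus 1).
Proof.
have zU : zset [set c : 'I_1 -> R | c ord0 = 0].
  by exists (fun c => c ord0) => //; apply: polyfun_coord.
have -> : torus 1 = [set: 'I_1 -> R] `\` [set c | c ord0 = 0].
  apply/seteqP; split=> c /=; first by move=> h; split=> //; apply/eqP.
  by move=> [_ h] i; rewrite ord1; apply/eqP.
apply: represents_sub => //; first exact: (represents_cls (glclosed_affine 1)).
(* The point [fone] is placed at the origin of the line, which is what has to be removed. *)
have [h1 h2 h3] := represents_Lneg 0.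
split=> //; first by rewrite setTI; apply: zset_lc.
by move=> K W hW; rewrite h3 // setTI cl_prod_point // cl_prod0.
Qed.

Lemma represents_torus (n : nat) : represents 0 (fpow (fsub fL fone) n) (torus n).
Proof.
elim: n => [|n ih].
  rewrite (_ : torus 0 = setT); first exact: represents_Lneg.
  by apply/seteqP; split=> // c _ [].
have := represents_mul represents_punctured_line ih; rewrite addn0.
have gK : bijective (@unsplit 1 n).
  by exists (@fintype.split _ _); [apply: unsplitK|apply: splitK].
move/(represents_reindex gK); rewrite /prodset /=.
rewrite (_ : [set y | _] = torus n.+1) //.
apply/seteqP; split=> y /=; last by move=> h; split=> i; apply: h.
move=> [h1 h2] i; rewrite -[i](@splitK 1 n).
by case: (fintype.split _) => j; [apply: h1|apply: h2].
Qed.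

(** * Coordinate changes *)

(** Applied once all conditions bear on single coordinates. Those in the image of [iota] carry [Y],
    those in [B] are free and make up the affine factor, and all others vanish. *)
Lemma cl_coord (I J : finType) (iota : J -> I) (B : {set I}) (d : nat)
    (Y : set (J -> R)) :
  injective iota -> (forall j, iota j \notin B) -> #|B| = d -> lcset Y ->
  cl [set x : I -> R | Y (fun j => x (iota j)) /\
        forall i, i \notin B -> (forall j, iota j != i) -> x i = 0] =
  cl (prodset Y [set: 'I_d -> R]).
Proof.
move=> inj hB <- hY.
pose psi (y : J + 'I_#|B| -> R) (i : I) : R :=
  match [pick j | iota j == i] with
  | Some j => y (inl j)
  | None => match [pick t : 'I_#|B| | enum_val t == i] with
            | Some t => y (inr t) | None => 0 end
  end.
have psil y j : psi y (iota j) = y (inl j).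
  rewrite /psi; case: pickP => [j' /eqP/inj->//|/(_ j)].
  by rewrite eqxx.
have psir y t : psi y (enum_val t) = y (inr t).
  rewrite /psi; case: pickP => [j' /eqP e|_].
    by have := hB j'; rewrite e enum_valP.
  case: pickP => [t' /eqP/enum_val_inj->//|/(_ t)].
  by rewrite eqxx.
apply: (@cl_iso _ _ _ _
  (fun x u => match u with inl j => x (iota j) | inr t => x (enum_val t) end) psi).
- apply: lcsetI; first exact: (lcset_reindex iota hY).
  apply: (@lcset_all _ _ (fun i => [set x : I -> R | i \notin B -> (forall j, iota j != i) -> x i = 0])) => i.
  have [[h1 h2]|h] := pselect (i \notin B /\ forall j, iota j != i); last first.
    rewrite (_ : [set x | _] = setT); first exact: lcsetT.
    by apply/seteqP; split=> // x _ /= h1 h2; case: h.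
  rewrite (_ : [set x | _] = [set x | x i = 0]); first exact: (lcset_eq0 (polyfun_coord i)).
  by apply/seteqP; split=> x /=; [apply|].
- by apply: lcset_prod => //; apply: lcsetT.
- by move=> [j|t]; apply/ratfun_poly/polyfun_coord.
- move=> i; apply: ratfun_poly; rewrite /psi.
  case: pickP => [j _|_]; first exact: polyfun_coord.
  by case: pickP => [t _|_]; [apply: polyfun_coord|apply: polyfun_cst].
- move=> x [hx h0]; split; first by split.
  apply/funext => i; rewrite /psi; case: pickP => [j /eqP<-//|hj].
  case: pickP => [t /eqP<-//|ht]; rewrite h0 // ?hj //.
    apply/negP => iB; have := ht (enum_rank_in iB i).
    by rewrite enum_rankK_in // eqxx.
  by move=> j; rewrite hj.
- move=> y [hy _]; split; last first.
    by apply/funext => -[j|t]; rewrite ?psil ?psir.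
  split=> [|i iB hi] /=.
    by move: hy; congr (Y _); apply/funext => j; rewrite psil.
  rewrite /psi; case: pickP => [j /eqP e|_]; first by have := hi j; rewrite e eqxx.
  by case: pickP => [t /eqP e|//]; move: iB; rewrite -e enum_valP.
Qed.

Definition upd (I : eqType) (x : I -> R) (e : I) (c : R) : I -> R :=
  fun i => if i == e then c else x i.

Lemma upd_upd (I : eqType) (x : I -> R) (e : I) (c d : R) :
  upd (upd x e c) e d = upd x e d.
Proof. by apply/funext => i; rewrite /upd; case: eqP. Qed.

Lemma upd_id (I : eqType) (x : I -> R) (e : I) : upd x e (x e) = x.
Proof. by apply/funext => i; rewrite /upd; case: eqP => // ->. Qed.

Lemma polyfun_upd (I : eqType) (p q : (I -> R) -> R) (e : I) :
  polyfun p -> polyfun q -> polyfun (fun x => p (upd x e (q x))).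
Proof.
move=> hp hq; apply: (@polyfun_comp _ _ (fun x => upd x e (q x))) => // i.
by rewrite /upd; case: eqP => // _; apply: polyfun_coord.
Qed.

(* x_e |-> F(x) = D x_e + F(x[e:=0]) is a change of variable where D does not vanish. *)
Lemma cl_eliminate (I : finType) (e : I) (D F : (I -> R) -> R) (B : set (I -> R)) (S : set R) :
  polyfun D -> polyfun F ->
  lcset [set x | B x /\ S (F x)] -> lcset [set x | B x /\ S (x e)] ->
  (forall x c, B x -> B (upd x e c)) ->
  (forall x c, D (upd x e c) = D x) ->
  (forall x, B x -> D x != 0) ->
  (forall x, B x -> F x = D x * x e + F (upd x e 0)) ->
  cl [set x | B x /\ S (F x)] = cl [set x | B x /\ S (x e)].
Proof.
move=> hD hF h1 h2 hB hDu hD0 hFD.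
have updE (x : I -> R) c : upd x e c e = c by rewrite /upd eqxx.
have pF0 : polyfun (fun y => F (upd y e 0)) by apply: polyfun_upd => //; apply: polyfun_cst.
have FE y : B y -> F (upd y e ((y e - F (upd y e 0)) / D y)) = y e.
  move=> hy; rewrite hFD; last exact: hB.
  by rewrite hDu updE upd_upd mulrCA divff ?mulr1 ?subrK //; apply: hD0.
apply: (@cl_iso _ _ _ _ (fun x => upd x e (F x))
  (fun y => upd y e ((y e - F (upd y e 0)) / D y))) => //.
- move=> i; apply: ratfun_poly; rewrite /upd.
  by case: eqP => // _; apply: polyfun_coord.
- move=> i; rewrite /upd; case: eqP => [_|_]; last by apply/ratfun_poly/polyfun_coord.
  exists (fun y => y e - F (upd y e 0)), D; split=> //.
    by apply: polyfunB => //; apply: polyfun_coord.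
  by move=> y [hy _]; split; [apply: hD0|].
- move=> x /= [hx hS]; split; first by rewrite updE; split=> //; apply: hB.
  rewrite updE upd_upd hDu upd_upd (hFD _ hx) addrK mulrAC divff ?mul1r ?upd_id //.
  exact: hD0.
- move=> y /= [hy hS]; split; first by rewrite FE //; split=> //; apply: hB.
  by rewrite FE // upd_upd upd_id.
Qed.

(** * Coefficients of f along an arc *)

Definition eqcoef (j : nat) (p q : {poly R}) : Prop := forall l, (l <= j)%N -> p`_l = q`_l.

Lemma eqcoefM (j : nat) (p p' q q' : {poly R}) :
  eqcoef j p p' -> eqcoef j q q' -> eqcoef j (p * q) (p' * q').
Proof.
move=> h1 h2 l hl; rewrite !coefM; apply: eq_bigr => i _.
by rewrite h1 ?h2 //; [apply: leq_trans hl; apply: leq_subr|apply: leq_trans hl; rewrite -ltnS].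
Qed.

Lemma eqcoefX (j : nat) (p p' : {poly R}) (e : nat) :
  eqcoef j p p' -> eqcoef j (p ^+ e) (p' ^+ e).
Proof. by move=> h; elim: e => [|e ih] //; rewrite !exprS; apply: eqcoefM. Qed.

Lemma eqcoef_prod (j : nat) (T : Type) (s : seq T) (P : pred T) (F G : T -> {poly R}) :
  (forall t, eqcoef j (F t) (G t)) ->
  eqcoef j (\prod_(t <- s | P t) F t) (\prod_(t <- s | P t) G t).
Proof.
by move=> h; elim/big_rec2: _ => // t p q _ hpq; apply: eqcoefM.
Qed.

Lemma mmap_polyE (n : nat) (f : {mpoly R[n]}) (A : 'I_n -> {poly R}) (j : nat) :
  (mmap (@polyC R) A f)`_j = \sum_(m <- msupp f) f@_m * (\prod_i A i ^+ m i)`_j.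
Proof.
rewrite /mmap coef_sum; apply: eq_bigr => m _.
by rewrite coefCM.
Qed.

Lemma eqcoef_mmap (n : nat) (f : {mpoly R[n]}) (j : nat) (A B : 'I_n -> {poly R}) :
  (forall i, eqcoef j (A i) (B i)) ->
  eqcoef j (mmap (@polyC R) A f) (mmap (@polyC R) B f).
Proof.
move=> h l hl; rewrite !mmap_polyE; apply: eq_bigr => m _; congr (_ * _).
by apply: (@eqcoef_prod j) => // i; apply: eqcoefX.
Qed.

Lemma eq_comp_coef (n : nat) (f : {mpoly R[n]}) (al be : Defs.arc n) (j : nat) :
  (forall i l, (l <= j)%N -> al i l = be i l) -> comp_coef f al j = comp_coef f be j.
Proof.
move=> h; apply: (@eqcoef_mmap _ _ j) => // i l hl.
by rewrite !coef_poly ltnS hl h.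
Qed.

Definition wt (n : nat) (a : 'I_n -> nat) (m : 'X_{1..n}) : nat := (\sum_i a i * m i)%N.

Definition initform (n : nat) (f : {mpoly R[n]}) (a : 'I_n -> nat) (mu : nat) : {mpoly R[n]} :=
  \sum_(m <- msupp f | wt a m == mu) f@_m *: 'X_[m].

Definition shift_poly (n : nat) (a : 'I_n -> nat) (al : Defs.arc n) (K : nat) (i : 'I_n) : {poly R} :=
  \poly_(l < K) al i (a i + l)%N.

(** Pulling ['X^(a i)] out of each component turns the monomial [m] into ['X^(wt a m)] times a
    product of shifted series. Cutting these at [K] is harmless, as only their coefficients up to
    t^j can contribute. *)
Lemma comp_coef_wt (n : nat) (f : {mpoly R[n]}) (a : 'I_n -> nat) (al : Defs.arc n) (j K : nat) :
  (forall i l, (l < a i)%N -> al i l = 0) -> (j < K)%N ->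
  comp_coef f al j = \sum_(m <- msupp f) f@_m *
    (if (j < wt a m)%N then 0 else (\prod_i shift_poly a al K i ^+ m i)`_(j - wt a m)).
Proof.
move=> h0 hK.
transitivity ((mmap (@polyC R) (fun i => 'X^(a i) * shift_poly a al K i) f)`_j).
  apply: (@eqcoef_mmap _ _ j) => // i l hl.
  rewrite coef_poly ltnS hl coefXnM; case: ltnP => hla; first exact: h0.
  rewrite coef_poly subnKC // ifT //.
  by apply: leq_ltn_trans hK; apply: leq_trans hl; apply: leq_subr.
rewrite mmap_polyE; apply: eq_bigr => m _; congr (_ * _).
rewrite (eq_bigr (fun i => 'X^(a i * m i) * shift_poly a al K i ^+ m i)); last first.
  by move=> i _; rewrite exprMn exprM.
by rewrite big_split /= prodrXr coefXnM.
Qed.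

Lemma comp_coef_lt (n : nat) (f : {mpoly R[n]}) (a : 'I_n -> nat) (al : Defs.arc n) (mu j : nat) :
  (forall i l, (l < a i)%N -> al i l = 0) ->
  (forall m, m \in msupp f -> (mu <= wt a m)%N) -> (j < mu)%N -> comp_coef f al j = 0.
Proof.
move=> h0 hmu hj; rewrite (comp_coef_wt _ h0 (ltnSn j)) big_seq big1 // => m /hmu hm.
by rewrite (leq_trans hj hm) mulr0.
Qed.

Lemma ev_initform (n : nat) (f : {mpoly R[n]}) (a : 'I_n -> nat) (mu : nat) (u : 'I_n -> R) :
  ev (initform f a mu) u = \sum_(m <- msupp f | wt a m == mu) f@_m * \prod_i u i ^+ m i.
Proof.
rewrite /ev /initform raddf_sum /=; apply: eq_bigr => m _.
by rewrite mevalZ mevalX.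
Qed.

Lemma ev_mderiv_initform (n : nat) (f : {mpoly R[n]}) (a : 'I_n -> nat) (mu : nat)
    (i : 'I_n) (u : 'I_n -> R) :
  ev (initform f a mu)^`M(i) u =
  \sum_(m <- msupp f | wt a m == mu) f@_m * ev 'X_[m]^`M(i) u.
Proof.
rewrite /initform; elim/big_rec2: _ => [|m x p _ <-]; first by rewrite mderiv0 /ev meval0.
by rewrite mderivD mderivZ /ev mevalD mevalZ.
Qed.

(** Monomials of larger weight start later. Those of weight [mu] contribute the constant term of a
    product of shifted series, and taking constant terms is multiplicative. *)
Lemma comp_coef_eq (n : nat) (f : {mpoly R[n]}) (a : 'I_n -> nat) (al : Defs.arc n) (mu : nat) :
  (forall i l, (l < a i)%N -> al i l = 0) ->
  (forall m, m \in msupp f -> (mu <= wt a m)%N) ->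
  comp_coef f al mu = ev (initform f a mu) (fun i => al i (a i)).
Proof.
move=> h0 hmu; rewrite (comp_coef_wt _ h0 (ltnSn mu)) ev_initform [RHS]big_mkcond /=.
rewrite big_seq [RHS]big_seq; apply: eq_bigr => m /hmu.
rewrite leq_eqVlt eq_sym => /orP[/eqP->|hm]; last by rewrite hm mulr0 gtn_eqF.
rewrite ltnn eqxx subnn; congr (_ * _).
have c0M (p q : {poly R}) : (p * q)`_0 = p`_0 * q`_0.
  by rewrite coefM big_ord1 subnn.
rewrite (big_morph (fun p : {poly R} => p`_0) c0M (coef1 _ 0)).
apply: eq_bigr => i _; elim: (m i) => [|e ih]; first by rewrite !expr0 coef1.
by rewrite !exprS c0M ih coef_poly /= addn0.
Qed.

(* First-order variation at t^j: the pair (value at 0, change of the t^j coefficient)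
   behaves as a dual number. *)
Definition varies (j : nat) (p p' : {poly R}) (u d : R) : Prop :=
  [/\ forall l, (l < j)%N -> p`_l = p'`_l, p`_j = p'`_j + d & p`_0 = u].

Lemma variesM (j : nat) (p p' q q' : {poly R}) (u d v e : R) : (0 < j)%N ->
  varies j p p' u d -> varies j q q' v e ->
  varies j (p * q) (p' * q') (u * v) (d * v + u * e).
Proof.
case: j => // j _ [hp1 hp2 hp3] [hq1 hq2 hq3]; split.
- move=> l hl; rewrite !coefM; apply: eq_bigr => i _.
  rewrite hp1 ?hq1 //; first by apply: leq_ltn_trans hl; apply: leq_subr.
  by apply: leq_trans hl; rewrite ltn_ord.
(* Since the degree is positive, the first and last terms of the convolution are distinct, and they
   are the only ones affected by the two changes. *)
- rewrite !coefM big_ord_recl big_ord_recr [in RHS]big_ord_recl [in RHS]big_ord_recr /=.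
  rewrite /bump /= !add1n !subn0 !subnn hp2 hq2 -!(hp1 0%N) // -!(hq1 0%N) // hp3 hq3.
  set s := \sum_(_ < _) _; set s' := \sum_(_ < _) _.
  have -> : s = s'.
    apply: eq_bigr => i _; rewrite /bump /= !add1n hp1 ?hq1 //.
      by rewrite subSS ltnS leq_subr.
    by rewrite ltnS.
  ring.
- by rewrite coefM big_ord1 subnn hp3 hq3.
Qed.

Lemma varies_refl (j : nat) (p : {poly R}) : varies j p p p`_0 0.
Proof. by split=> //; rewrite addr0. Qed.

Lemma variesX (j : nat) (p p' : {poly R}) (u d : R) (e : nat) : (0 < j)%N ->
  varies j p p' u d -> varies j (p ^+ e) (p' ^+ e) (u ^+ e) (e%:R * d * u ^+ e.-1).
Proof.
move=> hj h; elim: e => [|e ih].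
  by rewrite !mul0r !expr0 -[X in varies _ _ _ X _](coef1 R 0); apply: varies_refl.
have := variesM hj h ih; rewrite -!exprS.
rewrite (_ : _ + _ = e.+1%:R * d * u ^+ e.+1.-1) //=.
case: e {ih} => [|e] /=; first by rewrite !expr0; ring.
by rewrite !exprS [e.+2%:R]mulrS; ring.
Qed.

Lemma varies_monomial (n j : nat) (m : 'X_{1..n}) (i0 : 'I_n) (A B : 'I_n -> {poly R}) (d : R) :
  (0 < j)%N -> (forall i, i != i0 -> A i = B i) -> varies j (A i0) (B i0) (A i0)`_0 d ->
  varies j (\prod_i A i ^+ m i) (\prod_i B i ^+ m i)
    (\prod_i (A i)`_0 ^+ m i) (d * ev 'X_[m]^`M(i0) (fun i => (A i)`_0)).
Proof.
move=> hj hne h0.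
rewrite /ev mderivX mevalZ mevalX.
rewrite (bigD1 i0) //= [X in varies _ _ X](bigD1 i0) //=.
rewrite [X in varies _ _ _ X](bigD1 i0) //= [X in _ * (_ * X)](bigD1 i0) //=.
rewrite mnmBE mnm1E eqxx subn1.
rewrite [X in _ * (_ * (_ * X))](eq_bigr (fun i => (A i)`_0 ^+ m i)); last first.
  by move=> i hi; rewrite mnmBE mnm1E eq_sym (negbTE hi) subn0.
set P := \prod_(_ | _) _ ^+ _; set P' := \prod_(i | _) B _ ^+ _.
set V := \prod_(i | _) _`_0 ^+ _.
have -> : P' = P by apply: eq_bigr => i /hne ->.
have PV : P`_0 = V.
  have c0M (p q : {poly R}) : (p * q)`_0 = p`_0 * q`_0 by rewrite coefM big_ord1 subnn.
  rewrite /P (big_morph (fun p : {poly R} => p`_0) c0M (coef1 _ 0)).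
  apply: eq_bigr => i _; elim: (m i) => [|e ih]; first by rewrite !expr0 coef1.
  by rewrite !exprS c0M ih.
have := variesM hj (variesX (m i0) hj h0) (varies_refl j P).
rewrite PV (_ : _ + _ = d * ((m i0)%:R * ((A i0)`_0 ^+ (m i0).-1 * V))) //.
by ring.
Qed.

(** A monomial of weight w sees its shifted series only up to t^(mu+j-w), hence never beyond t^j,
    and reaches t^j only when w = [mu]. There the product rule turns the change into the partial
    derivative of the initial form. The formula is therefore exact, and later coefficients of
    component [i0] may differ freely. *)
Lemma comp_coef_varies (n : nat) (f : {mpoly R[n]}) (a : 'I_n -> nat) (al be : Defs.arc n)
    (mu j : nat) (i0 : 'I_n) :
  (forall i l, (l < a i)%N -> al i l = 0) ->
  (forall m, m \in msupp f -> (mu <= wt a m)%N) -> (0 < j)%N ->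
  (forall i l, i != i0 \/ (l < a i0 + j)%N -> al i l = be i l) ->
  comp_coef f al (mu + j) = comp_coef f be (mu + j) +
    (al i0 (a i0 + j)%N - be i0 (a i0 + j)%N) *
      ev (initform f a mu)^`M(i0) (fun i => al i (a i)).
Proof.
move=> h0 hmu hj hab.
have h0b i l : (l < a i)%N -> be i l = 0.
  move=> hl; rewrite -hab ?h0 //; have [e|] := eqVneq i i0; last by left.
  by right; apply: ltn_addr; rewrite -e.
rewrite (comp_coef_wt _ h0 (ltnSn _)) (comp_coef_wt _ h0b (ltnSn _)).
set K := (mu + j).+1; set d := _ - _.
set A := shift_poly a al K; set B := shift_poly a be K.
have A0 i : (A i)`_0 = al i (a i) by rewrite coef_poly /= addn0.
have AB i : i != i0 -> A i = B i.
  by move=> hi; apply/polyP => l; rewrite !coef_poly hab //; left.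
have V0 : varies j (A i0) (B i0) (A i0)`_0 d.
  split=> // [l hl|]; rewrite !coef_poly.
    by rewrite hab //; right; rewrite ltn_add2l.
  by rewrite !ifT ?/K ?ltnS ?leq_addl // /d subrKC.
have hV m := varies_monomial m hj AB V0.
rewrite ev_mderiv_initform [X in d * X]big_mkcond mulr_sumr -big_split.
rewrite big_seq [RHS]big_seq; apply: eq_bigr => m /hmu hm /=.
have [l1 l2 _] := hV m.
case: eqVneq => [->|ne].
  rewrite /K ltnNge leq_addr /= addKn l2 mulrDr; congr (_ + _).
  rewrite mulrCA /ev; congr (_ * (_ * meval _ _)).
  by apply/funext.
rewrite mulr0 addr0 /K; case: ltnP => // h; rewrite l1 //.
by rewrite ltn_subLR // ltn_add2r ltn_neqAle eq_sym ne.
Qed.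

Definition polycoef (I : Type) (P : (I -> R) -> {poly R}) : Prop :=
  forall j, polyfun (fun x => (P x)`_j).

Lemma polycoefM (I : Type) (P Q : (I -> R) -> {poly R}) :
  polycoef P -> polycoef Q -> polycoef (fun x => P x * Q x).
Proof.
move=> hP hQ j.
have -> : (fun x => (P x * Q x)`_j) = (fun x => \sum_(i < j.+1) (P x)`_i * (Q x)`_(j - i)).
  by apply/funext=> x; rewrite coefM.
by apply: polyfun_sum => i; apply: polyfunM.
Qed.

Lemma polyfun_comp_coef (I : Type) (n : nat) (f : {mpoly R[n]}) (al : (I -> R) -> Defs.arc n) (j : nat) :
  (forall i l, polyfun (fun x => al x i l)) -> polyfun (fun x => comp_coef f (al x) j).
Proof.
move=> h; rewrite /comp_coef.
have -> : (fun x => (mmap (@polyC R) (fun i => \poly_(l < j.+1) al x i l) f)`_j) =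
   (fun x => \sum_(m <- msupp f) f@_m * (\prod_i (\poly_(l < j.+1) al x i l) ^+ m i)`_j).
  by apply/funext => x; rewrite mmap_polyE.
apply: polyfun_sum => m; apply: polyfunM; first exact: polyfun_cst.
suff : polycoef (fun x => \prod_i (\poly_(l < j.+1) al x i l) ^+ m i) by apply.
have c1 : polycoef (fun x : I -> R => 1).
  by move=> l; rewrite coef1; apply: polyfun_cst.
elim: (index_enum _) => [|i s ih].
  by have -> : (fun x => \prod_(i <- [::]) (\poly_(l < j.+1) al x i l) ^+ m i) = (fun=> 1)
    by apply/funext => x; rewrite big_nil.
have -> : (fun x => \prod_(i <- i :: s) (\poly_(l < j.+1) al x i l) ^+ m i) =
  (fun x => (\poly_(l < j.+1) al x i l) ^+ m i * \prod_(i <- s) (\poly_(l < j.+1) al x i l) ^+ m i).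
  by apply/funext => x; rewrite big_cons.
apply: polycoefM => //; elim: (m i) => [|e ih']; first exact: c1.
have -> : (fun x => (\poly_(l < j.+1) al x i l) ^+ e.+1) =
  (fun x => (\poly_(l < j.+1) al x i l) * (\poly_(l < j.+1) al x i l) ^+ e).
  by apply/funext => x; rewrite exprS.
apply: polycoefM => // l.
have -> : (fun x => (\poly_(l0 < j.+1) al x i l0)`_l) = (fun x => if (l < j.+1)%N then al x i l else 0).
  by apply/funext => x; rewrite coef_poly.
by case: (l < j.+1)%N; [apply: h|apply: polyfun_cst].
Qed.

(** * The Newton polyhedron *)

Import normed_module.numFieldNormedType.Exports.

Lemma continuous_fprod (T : topologicalType) (I : Type) (g : T -> I -> R) :
  (forall i, continuous (fun x => g x i)) -> continuous g.
Proof.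
move=> h x; apply/cvg_sup => i U.
have /= -> := @nbhsE (initial_topology (@mathcomp_extra.proj I (fun=> R) i)) (g x).
move=> [B [[C oC <-] gxC]] BU.
apply: (filterS BU); apply: (h i x).
exact: open_nbhs_nbhs.
Qed.

Lemma continuousD_real (K : realType) (T : topologicalType) (F G : T -> K) :
  continuous F -> continuous G -> continuous (fun x => F x + G x).
Proof. by move=> hF hG x; apply: pseudometric_normed_Zmodule.cvgD; [apply: hF|apply: hG]. Qed.

Lemma continuousMr_real (K : realType) (T : topologicalType) (F : T -> K) (c : K) :
  continuous F -> continuous (fun x => F x * c).
Proof. by move=> hF x; apply: normed_module.cvgMr_tmp; apply: hF. Qed.

Lemma closed_eq_real (K : realType) (y : K) : closed [set x | x = y].
Proof. exact: num_normedtype.closed_eq. Qed.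

Lemma segment_compact_real (K : realType) (a b : K) : compact [set x : K | a <= x <= b].
Proof.
rewrite (_ : [set x | _] = [set` `[a, b]%R]); first exact: normed_module.segment_compact.
by apply/seteqP; split=> x /=; rewrite in_itv.
Qed.

Lemma continuous_lincomb (T : topologicalType) (J : Type) (s : seq J) (P : pred J)
  (F : J -> T -> R) (c : J -> R) :
  (forall t, continuous (F t)) -> continuous (fun x => \sum_(t <- s | P t) F t x * c t).
Proof.
move=> h; elim: s => [|t s ih].
  have -> : (fun x => \sum_(t <- [::] | P t) F t x * c t) = (fun=> 0).
    by apply/funext=> x; rewrite big_nil.
  by move=> x; apply: cvg_cst.
have -> : (fun x => \sum_(t <- t :: s | P t) F t x * c t) =
    (fun x => (if P t then F t x * c t else 0) + \sum_(t <- s | P t) F t x * c t).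
  by apply/funext=> x; rewrite big_cons; case: (P t); rewrite ?add0r.
have c1 : continuous (fun x => if P t then F t x * c t else 0).
  move=> x; case: (P t); last exact: cvg_cst.
  by apply: (@continuousMr_real Rdefinitions.R); exact: h.
exact: (@continuousD_real Rdefinitions.R).
Qed.

Definition natvec (n : nat) (a : 'I_n -> nat) : 'I_n -> R := fun i => (a i)%:R.

Lemma dotp_expv (n : nat) (a : 'I_n -> nat) (m : 'X_{1..n}) :
  dotp (natvec a) (expv m) = (wt a m)%:R.
Proof.
by rewrite /dotp /wt natr_sum; apply: eq_bigr => i _; rewrite natrM.
Qed.

Lemma Gamma_gens (n : nat) (f : {mpoly R[n]}) : newton_gens f `<=` Gamma f.
Proof. by move=> p hp C _; apply. Qed.

Lemma Gamma_expv (n : nat) (f : {mpoly R[n]}) m : m \in msupp f -> Gamma f (expv m).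
Proof. by move=> hm; apply: Gamma_gens; exists m. Qed.

Lemma convex_set_Gamma (n : nat) (f : {mpoly R[n]}) : convex_set (Gamma f).
Proof.
move=> x y hx hy t t0 t1 C hC hf.
by apply: (hC) => //; [exact: (hx C hC hf)|exact: (hy C hC hf)].
Qed.

(** The weights are divided by their sum instead of adding up to 1, so that the tail of the list is
    again an instance of the statement. *)
Lemma convex_sum (n : nat) (C : set ('I_n -> R)) (T : Type) (s : seq T)
    (l : T -> R) (p : T -> 'I_n -> R) :
  convex_set C -> (forall t, 0 <= l t) -> (forall t, List.In t s -> C (p t)) ->
  0 < \sum_(t <- s) l t ->
  C (fun i => (\sum_(t <- s) l t * p t i) / \sum_(t <- s) l t).
Proof.
move=> hC l0; elim: s => [|t s ih] hp; first by rewrite big_nil ltxx.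
rewrite big_cons => hpos.
have hs : 0 <= \sum_(t <- s) l t by apply: sumr_ge0.
have hpt := hp t (or_introl erefl).
have {}hp u : List.In u s -> C (p u) by move=> hu; apply: hp; right.
have [s0|sn0] := eqVneq (\sum_(t <- s) l t) 0.
  rewrite s0 addr0 in hpos *.
  rewrite (_ : (fun i => _) = p t) //; apply/funext => i; rewrite big_cons.
  have [z _] : (forall u, List.In u s -> l u = 0) /\ True.
    split=> //; elim: s s0 {ih hs hp} => [|v s ih] //=; rewrite big_cons => /eqP.
    rewrite paddr_eq0 // ?sumr_ge0 // => /andP[/eqP v0 /eqP s0] u [<-//|]; exact: ih.
  rewrite (_ : \sum_(u <- s) l u * p u i = 0).
    by rewrite addr0 mulrAC divff ?mul1r // gt_eqF.
  elim: s z {s0 ih hs hp} => [|v s ih] z; first by rewrite big_nil.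
  by rewrite big_cons z ?mul0r ?add0r ?ih //=; [move=> u hu; apply: z; right|left].
have sp : 0 < \sum_(t <- s) l t by rewrite lt_neqAle eq_sym sn0.
have {}ih := ih hp sp.
set S := \sum_(t <- s) l t in hpos hs sn0 sp ih *.
(* The head is combined with the normalised tail; this parameter is the share of the tail in the
   total weight. *)
have := hC _ _ hpt ih (S / (l t + S)) _ _.
have ne : l t + S != 0 by rewrite gt_eqF.
rewrite (_ : (fun i => (1 - _) * _ + _) =
  (fun i => (\sum_(j <- t :: s) l j * p j i) / (l t + S))).
  apply; first by rewrite divr_ge0 // ltW.
  by rewrite ler_pdivrMr // mul1r lerDr.
apply/funext => i; rewrite big_cons; field.
by rewrite ne sn0.
Qed.

Lemma dotp_comb (n : nat) (a x y : 'I_n -> R) (t : R) :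
  dotp a (fun i => (1 - t) * x i + t * y i) = (1 - t) * dotp a x + t * dotp a y.
Proof.
rewrite /dotp !mulr_sumr -big_split; apply: eq_bigr => i _ /=; ring.
Qed.

(** [Gamma] lies in every convex set that contains the generators; the half-space is one, because
    the entries of [a] are nonnegative. *)
Lemma dotp_Gamma_ge (n : nat) (f : {mpoly R[n]}) (a : 'I_n -> nat) (mu : nat) :
  (forall m, m \in msupp f -> (mu <= wt a m)%N) ->
  forall p, Gamma f p -> mu%:R <= dotp (natvec a) p.
Proof.
move=> hmu p hp; apply: (hp [set p | mu%:R <= dotp (natvec a) p]).
  move=> x y hx hy t t0 t1; rewrite /= dotp_comb.
  have -> : mu%:R = (1 - t) * mu%:R + t * mu%:R :> R by ring.
  by apply: lerD; apply: ler_wpM2l => //; rewrite subr_ge0.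
move=> q [m /hmu hm hq] /=; apply: (@le_trans _ _ (wt a m)%:R).
  by rewrite ler_nat.
rewrite -dotp_expv; apply: ler_sum => i _; exact: ler_wpM2l.
Qed.

(** The value m_f(a) for natural weights, read off the support of [f] as an attained minimum rather
    than as an infimum over [Gamma]. *)
Definition is_minwt (n : nat) (f : {mpoly R[n]}) (a : 'I_n -> nat) (mu : nat) : Prop :=
  (forall m, m \in msupp f -> (mu <= wt a m)%N) /\ exists2 m, m \in msupp f & wt a m = mu.

Lemma minwt_exists (n : nat) (f : {mpoly R[n]}) (a : 'I_n -> nat) :
  msupp f <> [::] -> exists mu, is_minwt f a mu.
Proof.
move=> hf; have hex : exists mu, has (fun m => wt a m == mu) (msupp f).
  case: (msupp f) hf => // m s _; exists (wt a m).
  by rewrite /= eqxx.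
exists (ex_minn hex); case: ex_minnP => mu /hasP[m hm /eqP e] hmin; split; last by exists m.
by move=> m' hm'; apply: hmin; apply/hasP; exists m'.
Qed.

Lemma mf_minwt (n : nat) (f : {mpoly R[n]}) (a : 'I_n -> nat) (mu : nat) :
  is_minwt f a mu -> mf f (natvec a) = mu%:R.
Proof.
move=> [h1 [m0 hm0 e0]]; rewrite /mf.
have hin : [set dotp (natvec a) p | p in Gamma f] mu%:R.
  by exists (expv m0); [apply: Gamma_expv|rewrite dotp_expv e0].
have hlb : lbound [set dotp (natvec a) p | p in Gamma f] mu%:R.
  by move=> _ [p hp <-]; exact: (dotp_Gamma_ge h1 hp).
apply/eqP; rewrite eq_le; apply/andP; split.
  exact: (ge_inf (ex_intro _ _ hlb) hin).
exact: (lb_le_inf (ex_intro _ _ hin) hlb).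
Qed.

Lemma gammaf_expv (n : nat) (f : {mpoly R[n]}) (a : 'I_n -> nat) (mu : nat) m :
  is_minwt f a mu -> m \in msupp f -> gammaf f (natvec a) (expv m) <-> wt a m = mu.
Proof.
move=> hmu hm; rewrite /gammaf /= dotp_expv (mf_minwt hmu); split=> [[_ /eqP]|->].
  by rewrite eqr_nat => /eqP.
by split=> //; apply: Gamma_expv.
Qed.

Lemma fface_initform (n : nat) (f : {mpoly R[n]}) (a : 'I_n -> nat) (mu : nat) :
  is_minwt f a mu -> fface f (gammaf f (natvec a)) = initform f a mu.
Proof.
move=> hmu; rewrite /fface /initform big_seq_cond [RHS]big_seq_cond.
apply: eq_bigl => m; case hm: (m \in msupp f) => //=.
by apply/asboolP/eqP => /(gammaf_expv hmu hm).
Qed.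

Lemma face_gammaf (n : nat) (f : {mpoly R[n]}) (a : 'I_n -> nat) :
  face f (gammaf f (natvec a)).
Proof. by exists (natvec a); split=> // i; rewrite ler0n. Qed.

(* A compact face is the image of a compact piece of the standard simplex. *)
Lemma compact_gammaf (n : nat) (f : {mpoly R[n]}) (a : 'I_n -> nat) :
  (forall i, (0 < a i)%N) -> compact (gammaf f (natvec a)).
Proof.
move=> a0; pose r := size (msupp f).
pose pt (t : 'I_r) : 'I_n -> R := expv (nth 0%MM (msupp f) t).
pose comb (l : 'I_r -> R) (i : 'I_n) : R := \sum_t l t * pt t i.
have ptG t : newton_gens f (pt t).
  by exists (nth 0%MM (msupp f) t); first exact: mem_nth.
pose simplex := [set l : 'I_r -> R | (forall t, 0 <= l t) /\ \sum_t l t = 1].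
(* Every point of [Gamma] dominates a convex combination of exponents: the points that do so form a
   convex set containing the generators. *)
have GammaE p : Gamma f p -> exists2 l, simplex l & forall i, comb l i <= p i.
  move=> hp; apply: (hp [set p | exists2 l, simplex l & forall i, comb l i <= p i]).
    move=> x y [l [l0 l1] hl] [l' [l0' l1'] hl'] t t0 t1 /=.
    exists (fun u => (1 - t) * l u + t * l' u).
      split=> [u|]; first by rewrite addr_ge0 // mulr_ge0 // subr_ge0.
      by rewrite big_split /= -!mulr_sumr l1 l1' !mulr1 subrK.
    move=> i; rewrite /comb (eq_bigr (fun u => (1 - t) * (l u * pt u i) + t * (l' u * pt u i))).
      rewrite big_split /= -!mulr_sumr; by apply: lerD; apply: ler_wpM2l; rewrite ?subr_ge0 //; [apply: hl|apply: hl'].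
    by move=> u _; ring.
  move=> q [m hm hq].
  have hi : (index m (msupp f) < r)%N by rewrite index_mem.
  exists (fun t => (t == Ordinal hi)%:R).
    split=> [t|]; first exact: ler0n.
    by rewrite (bigD1 (Ordinal hi)) //= eqxx big1 ?addr0 // => t /negbTE ->.
  move=> i; rewrite /comb (bigD1 (Ordinal hi)) //= eqxx mul1r big1 ?addr0.
    by rewrite /pt nth_index.
  by move=> t /negbTE ->; rewrite mul0r.
have combG l : simplex l -> Gamma f (comb l).
  move=> [l0 l1].
  have := @convex_sum _ (Gamma f) _ (index_enum _) l pt (@convex_set_Gamma _ f) l0.
  rewrite l1 ltr01 => /(_ (fun t _ => Gamma_gens (ptG t)) isT).
  by rewrite (_ : (fun i => _) = comb l) //; apply/funext => i; rewrite divr1.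
have hle p : Gamma f p -> mf f (natvec a) <= dotp (natvec a) p.
  move=> hp.
  have hlb : lbound [set dotp (natvec a) p | p in Gamma f] 0%:R.
    by move=> _ [q hq <-]; exact: (@dotp_Gamma_ge _ f a 0 (fun _ _ => isT) q hq).
  by apply: (ge_inf (ex_intro _ _ hlb)); exists p.
(* The weights of the points on the face: a closed part of a cube, hence compact by Tychonoff. The
   factor [1] gives the second condition the shape of [continuous_lincomb]. *)
pose K := [set l : 'I_r -> R | forall t, 0 <= l t <= 1] `&`
  ([set l | \sum_t l t * 1 = 1] `&`
   [set l | \sum_t l t * dotp (natvec a) (pt t) = mf f (natvec a)]).
have dotc l : dotp (natvec a) (comb l) = \sum_t l t * dotp (natvec a) (pt t).
  rewrite /dotp /comb.
  under eq_bigr do rewrite mulr_sumr.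
  rewrite exchange_big; apply: eq_bigr => t _; rewrite mulr_sumr.
  by apply: eq_bigr => i _; ring.
have projc t : continuous (fun l : 'I_r -> R => l t).
  exact: (@proj_continuous _ (fun=> R) t).
have -> : gammaf f (natvec a) = comb @` K.
  apply/seteqP; split=> p.
    move=> [hp ep]; have [l hl le] := GammaE _ hp; exists l.
      split; last split.
      - move=> t; case: hl => l0 l1; rewrite l0 -l1 (bigD1 t) //= lerDl.
        exact: sumr_ge0.
      - by case: hl => _ e; rewrite /= -[RHS]e; apply: eq_bigr => t _; rewrite mulr1.
      - rewrite /= -dotc; apply/eqP; rewrite eq_le hle ?andbT; last exact: combG.
        rewrite -ep; apply: ler_sum => i _.
        by apply: ler_wpM2l; [apply: ler0n|apply: le].
    (* The point [p] dominates [comb l] and has the same product with [a]. As all [a i] are positive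
       the two coincide, so the face has no unbounded direction. *)
    have e : \sum_i (a i)%:R * (p i - comb l i) = 0.
      rewrite (eq_bigr (fun i => natvec a i * p i - natvec a i * comb l i)).
        rewrite sumrB; apply/eqP; rewrite subr_eq0 eq_le.
        rewrite -/(dotp _ p) -/(dotp _ (comb l)) ep hle /=; last exact: combG.
        by rewrite -ep; apply: ler_sum => i _; apply: ler_wpM2l; [apply: ler0n|apply: le].
      by move=> i _; rewrite mulrBr.
    apply/funext => i; move/eqP: e; rewrite psumr_eq0; last first.
      by move=> j _; rewrite mulr_ge0 ?ler0n // subr_ge0.
    move/allP/(_ i (mem_index_enum i)) => /=.
    by rewrite mulf_eq0 pnatr_eq0 eqn0Ngt a0 /= subr_eq0 => /eqP.
  move=> [l [hl1 [hl2 hl3]] <-].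
  have hl : simplex l.
    split=> [t|]; first by case/andP: (hl1 t).
    by rewrite -[RHS]hl2; apply: eq_bigr => t _; rewrite mulr1.
  by split; [apply: combG|rewrite dotc].
apply: continuous_compact.
  apply: continuous_subspaceT; apply: continuous_fprod => i.
  exact: continuous_lincomb.
apply: compact_closedI.
  apply: (@tychonoff _ (fun=> R) (fun=> [set x | 0 <= x <= 1])) => t.
  exact: (@segment_compact_real Rdefinitions.R).
apply: closedI.
  apply: (@preimage_closed _ _ (fun l : 'I_r -> R => \sum_t l t * 1) [set x | x = 1]).
    by move=> l _; apply: continuous_lincomb.
  exact: (@closed_eq_real Rdefinitions.R).
apply: (@preimage_closed _ _ (fun l : 'I_r -> R => \sum_t l t * _) [set x | x = mf f (natvec a)]).
  by move=> l _; apply: continuous_lincomb.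
exact: (@closed_eq_real Rdefinitions.R).
Qed.

(** For f = 0 the face polynomials and all their derivatives vanish, against non-degeneracy on the
    compact face cut out by the weights 1. A nonempty support is what makes m_f(a) an attained
    minimum. *)
Lemma nondegenerate_msupp (n : nat) (f : {mpoly R[n]}) :
  newton_nondegenerate f -> msupp f <> [::].
Proof.
move=> hnd e.
have f0 g : fface f g = 0 by rewrite /fface e big_nil.
have hc := @compact_gammaf n f (fun=> 1%N) (fun=> isT).
have h1 : forall i : 'I_n, (fun=> 1 : R) i != 0 by move=> i; apply: oner_neq0.
have := hnd _ (face_gammaf f (fun=> 1%N)) hc (fun=> 1) h1.
rewrite !f0 /ev meval0 => /(_ erefl)[i].
by rewrite mderiv0 meval0 eqxx.
Qed.

(** * Jets of given order *)

(* S = {c <> 0}, {1}, {-1} give A_k, A_k^+ and A_k^-. *)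
Definition arcs (n : nat) (f : {mpoly R[n]}) (k : nat) (S : set R) : set (Defs.arc n) :=
  [set alpha | (forall i, alpha i 0%N = 0) /\
     (forall j, (j < k)%N -> comp_coef f alpha j = 0) /\ S (comp_coef f alpha k)].

Definition lcset_line (S : set R) : Prop := lcset [set c : 'I_1 -> R | S (c ord0)].

Lemma lcset_line_preim (I : Type) (p : (I -> R) -> R) (S : set R) :
  lcset_line S -> polyfun p -> lcset [set x | S (p x)].
Proof.
move=> hS hp; exact: (@lcset_preim I 'I_1 (fun x _ => p x) _ (fun _ => hp) hS).
Qed.

Lemma lcset_all_lt (I : Type) (k : nat) (F : nat -> set (I -> R)) :
  (forall j, lcset (F j)) -> lcset [set x | forall j, (j < k)%N -> F j x].
Proof.
move=> hF; rewrite (_ : mkset _ = [set x | forall j : 'I_k, F j x]).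
  by apply: (@lcset_all _ _ (fun j : 'I_k => F j)).
by apply/seteqP; split=> x /= h j => [|hj]; [apply: h|apply: (h (Ordinal hj))].
Qed.

Section JetSpace.
Variables (n N' d : nat).
Local Notation N := N'.+1.
Local Notation Ix := ('I_n * 'I_N)%type.

(* The jet coordinate (i, l) is the coefficient of t^(l+1). *)
Definition jet_arc (x : Ix -> R) : Defs.arc n := fun i l =>
  if (0 < l <= N)%N then x (i, inord l.-1) else 0.

Lemma polyfun_jet_arc i l : polyfun (fun x => jet_arc x i l).
Proof.
rewrite /jet_arc; case: (0 < l <= N)%N; [exact: polyfun_coord|exact: polyfun_cst].
Qed.

Definition jets (f : {mpoly R[n]}) (k : nat) (S : set R) : set (Ix -> R) :=
  [set x | (forall j, (j < k)%N -> comp_coef f (jet_arc x) j = 0) /\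
           S (comp_coef f (jet_arc x) k)].

Lemma polyfun_jet_coef (f : {mpoly R[n]}) (j : nat) :
  polyfun (fun x => comp_coef f (jet_arc x) j).
Proof. by apply: polyfun_comp_coef => i l; apply: polyfun_jet_arc. Qed.

Lemma lcset_jets (f : {mpoly R[n]}) (k : nat) (S : set R) :
  lcset_line S -> lcset (jets f k S).
Proof.
move=> hS; apply: lcsetI.
  apply: (@lcset_all_lt _ _ (fun j => [set x | comp_coef f (jet_arc x) j = 0])) => j.
  by apply: lcset_eq0; apply: polyfun_jet_coef.
by apply: lcset_line_preim => //; apply: polyfun_jet_coef.
Qed.

(** The coefficients up to t^k depend only on the N-jet, and a jet lifts to an arc by adding zero
    coefficients. *)
Lemma gset_pjet (f : {mpoly R[n]}) (k : nat) (S : set R) : (k <= N)%N ->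
  pjet N (arcs f k S) = @Gen #|{: Ix}| [set v | jets f k S (fun il => v (enum_rank il))].
Proof.
move=> kN; congr Gen; apply/seteqP; split=> v /=.
  move=> [al [[h0 [h1 h2]] ->]].
  have e j : (j <= k)%N ->
      comp_coef f (jet_arc (fun il => @jetv n N al (enum_rank il))) j = comp_coef f al j.
    move=> hj; apply: eq_comp_coef => i [|l] hl; first by rewrite /jet_arc /= h0.
    have lN : (l < N)%N by apply: leq_trans kN; apply: leq_trans hj.
    by rewrite /jet_arc /= lN /jetv enum_rankK /= inordK.
  by split=> [j hj|]; rewrite e //; [apply: h1|apply: ltnW].
move=> [h1 h2]; exists (jet_arc (fun il => v (enum_rank il))); split=> //.
apply/funext => p; rewrite /jetv /jet_arc /= ltn_ord inord_val.
by rewrite -surjective_pairing enum_valK.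
Qed.

Lemma gclass_gen_affine (I : finType) (X : set (I -> R)) (e : nat) : lcset X ->
  gclass (gprod (@Gen #|I| [set v | X (fun i => v (enum_rank i))]) (affine e)) =
  cl (prodset X [set: 'I_e -> R]).
Proof.
move=> hX; rewrite gprod_cl; last exact: glclosed_affine.
  pose g (u : 'I_#|I| + 'I_e) : I + 'I_e :=
    match u with inl i => inl (enum_val i) | inr t => inr t end.
  pose g' (u : I + 'I_e) : 'I_#|I| + 'I_e :=
    match u with inl i => inl (enum_rank i) | inr t => inr t end.
  rewrite (@cl_reindex _ _ _ g).
  - congr cl; apply/seteqP; split=> z [h1 h2]; split=> //; move: h1 => /=;
    by congr X; apply/funext => i; rewrite enum_rankK.
  - exists g'; first by case=> // i; rewrite /= enum_valK.
    by case=> // i; rewrite /= enum_rankK.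
  - by apply: lcset_prod; [apply: lcset_reindex|apply: lcsetT].
by apply/lclosedP; apply: lcset_reindex.
Qed.

Local Notation I := (Ix + 'I_d)%type.

Definition jarc (z : I -> R) : Defs.arc n := jet_arc (fun p => z (inl p)).

Lemma polyfun_jarc i l : polyfun (fun z => jarc z i l).
Proof. exact: (polyfun_reindex inl (polyfun_jet_arc i l)). Qed.

Lemma polyfun_jarc_coef (f : {mpoly R[n]}) (j : nat) :
  polyfun (fun z => comp_coef f (jarc z) j).
Proof. by apply: polyfun_comp_coef => i l; apply: polyfun_jarc. Qed.

(* The coordinates in 'I_d are free: they realise the factor L^d of the jet space. *)
Definition has_order (a : 'I_n -> nat) : set (I -> R) :=
  [set z | forall i, (forall l, (l < a i)%N -> jarc z i l = 0) /\ jarc z i (a i) != 0].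

Lemma lcset_has_order (a : 'I_n -> nat) : lcset (has_order a).
Proof.
apply: (@lcset_all _ _ (fun i => [set z | (forall l, (l < a i)%N -> jarc z i l = 0) /\
  jarc z i (a i) != 0])) => i; apply: lcsetI.
  apply: (@lcset_all_lt _ _ (fun l => [set z | jarc z i l = 0])) => l.
  by apply: lcset_eq0; apply: polyfun_jarc.
by apply: lcset_neq0; apply: polyfun_jarc.
Qed.

Definition lead (a : 'I_n -> nat) (z : I -> R) : 'I_n -> R := fun i => jarc z i (a i).

Lemma lcset_lead (a : 'I_n -> nat) (U : set ('I_n -> R)) :
  lcset U -> lcset [set z | U (lead a z)].
Proof.
by move=> hU; apply: (@lcset_preim _ _ (lead a)) => // i; apply: polyfun_jarc.
Qed.

Section Order.
Variable (a : 'I_n -> nat).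
Hypothesis a0 : forall i, (0 < a i)%N.
Hypothesis aN : forall i, (a i <= N)%N.

Definition lead_coord (i : 'I_n) : I := inl (i, inord (a i).-1).

Lemma lead_coordE z i : lead a z i = z (lead_coord i).
Proof. by rewrite /lead /jarc /jet_arc a0 aN. Qed.

(** Coordinate (i, l) holds the coefficient of t^(l+1), so the non-strict inequality selects the
    coefficients strictly after the leading one; the idle coordinates are all free. *)
Definition free_coords : {set I} :=
  [set u : I | match u with inl p => (a p.1 <= p.2)%N | inr _ => true end].

Lemma card_free_coords : #|free_coords| = (N * n + d - \sum_i a i)%N.
Proof.
rewrite -sum1dep_card big_mkcond /= big_sumType /=.
rewrite [X in (_ + X)%N]sum_nat_const card_ord muln1.
have -> : (\sum_(i : Ix) (if (a i.1 <= i.2)%N then 1 else 0) = \sum_i (N - a i))%N.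
  rewrite -(pair_bigA _ (fun i (l : 'I_N) => if (a i <= l)%N then 1%N else 0%N)) /=.
  apply: eq_bigr => i _; rewrite -big_mkcond /= sum1dep_card.
  have <- : #|[set: 'I_(N - a i)]%SET| = (N - a i)%N by rewrite cardsT card_ord.
  have hlt (t : 'I_(N - a i)) : (a i + t < N)%N.
    by have := ltn_ord t; rewrite ltn_subRL.
  rewrite -(card_imset _ (f := fun t : 'I_(N - a i) => Ordinal (hlt t))).
    apply: eq_card => l; rewrite !inE; apply/idP/imsetP => [hl|[t _ ->]]; last exact: leq_addr.
    have hl' : (l - a i < N - a i)%N by rewrite ltn_sub2r // (leq_ltn_trans hl).
    by exists (Ordinal hl') => //; apply: val_inj; rewrite /= subnKC.
  by move=> t t' /(congr1 val) /= /addnI /val_inj.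
have e : (\sum_i (N - a i) + \sum_i a i = N * n)%N.
  rewrite -big_split /= (eq_bigr (fun=> N)) => [|i _]; last by rewrite subnK.
  by rewrite sum_nat_const card_ord mulnC.
by rewrite -e addnAC addnK.
Qed.

Lemma has_orderE z : has_order a z <->
  torus n (lead a z) /\ forall u, u \notin free_coords -> (forall i, lead_coord i != u) -> z u = 0.
Proof.
split.
  move=> h; split=> [i|[[i l]|t]]; first by case: (h i).
    rewrite !inE /= -ltnNge => hl hne; have [+ _] := h i.
    have {}hne : l.+1 != a i.
      apply: contra (hne i) => /eqP e; apply/eqP; congr (inl (i, _)).
      by apply: val_inj; rewrite /= -e /= inordK.
    move/(_ l.+1); rewrite ltn_neqAle hne /= => /(_ hl).
    by rewrite /jarc /jet_arc /= ltn_ord inord_val.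
  by rewrite inE.
move=> [h1 h2] i; split; last exact: (h1 i).
move=> l hl; rewrite /jarc /jet_arc; case: ifP => // /andP[l0 lN].
have hl' : (l.-1 < N)%N by rewrite prednK.
apply: h2.
  rewrite inE /= inordK // -ltnNge; apply: leq_trans hl; by rewrite prednK.
move=> i'; apply/negP => /eqP[ei] /(congr1 val) /=.
rewrite ei !inordK //; last by rewrite prednK.
move=> e; move: hl; rewrite -(prednK l0) -e prednK ?ltnn //.
Qed.

Lemma cl_order_lead (Y : set ('I_n -> R)) : lcset Y -> Y `<=` torus n ->
  cl [set z | has_order a z /\ Y (lead a z)] =
  cl (prodset Y [set: 'I_(N * n + d - \sum_i a i) -> R]).
Proof.
move=> hY Yt; rewrite -(@cl_coord _ _ lead_coord free_coords _ Y) //.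
- congr cl; apply/seteqP; split=> z /=.
    move=> [/has_orderE[_ h] hy]; split=> //.
    by move: hy; congr Y; apply/funext => i; rewrite lead_coordE.
  move=> [hy h].
  have {}hy : Y (lead a z) by move: hy; congr Y; apply/funext => i; rewrite lead_coordE.
  by split=> //; apply/has_orderE; split=> //; apply: Yt.
- by move=> i j [].
- by move=> j; rewrite inE /= inordK ?prednK // -ltnNge ltn_predL a0.
- exact: card_free_coords.
Qed.

(** * Trading tail coordinates of one component for coefficients of f along the arc *)

Section Tail.
Variables (f : {mpoly R[n]}) (mu r : nat) (i0 : 'I_n).
Hypothesis hmu : forall m, m \in msupp f -> (mu <= wt a m)%N.
Hypothesis hr : (a i0 + r <= N)%N.

Definition tail_coord (j : nat) : I := inl (i0, inord (a i0 + j).-1).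

Lemma jarc_tail z j : (0 < j <= r)%N -> jarc z i0 (a i0 + j) = z (tail_coord j).
Proof.
move=> /andP[j0 jr]; rewrite /jarc /jet_arc ifT //.
by rewrite addn_gt0 a0 /=; apply: leq_trans hr; rewrite leq_add2l.
Qed.

Lemma tail_bound j : (0 < j <= r)%N -> ((a i0 + j).-1 < N)%N.
Proof. by have := a0 i0; move: hr; lia. Qed.

Lemma tail_coord_inj j j' : (0 < j <= r)%N -> (0 < j' <= r)%N ->
  tail_coord j = tail_coord j' -> j = j'.
Proof.
move=> h h' [] /(congr1 val) /=; rewrite !inordK ?tail_bound //.
by have := a0 i0; move: h h'; lia.
Qed.

Lemma jarc_upd z j c i l : (0 < j <= r)%N ->
  jarc (upd z (tail_coord j) c) i l =
  if (i == i0) && (l == a i0 + j)%N then c else jarc z i l.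
Proof.
move=> hj; have [/andP[/eqP-> /eqP->]|h] := boolP ((i == i0) && _).
  by rewrite jarc_tail // /upd eqxx.
rewrite /jarc /jet_arc; case: ifP => // /andP[l0 lN]; rewrite /upd ifN //.
apply: contra h => /eqP [-> e]; rewrite eqxx /=; apply/eqP.
move/(congr1 val): e => /=; rewrite !inordK ?tail_bound //; last by rewrite prednK.
by have := a0 i0; move: hj l0; lia.
Qed.

(** Interpolates between conditions on coefficients of f along the arc, at [t = r], and the same
    conditions on bare coordinates, at [t = 0]. Index j stands for the power mu + j + 1. *)
Definition tail_set (U : set ('I_n -> R)) (cond : nat -> set R) (t : nat) : set (I -> R) :=
  [set z | (has_order a z /\ U (lead a z)) /\ forall j, (j < r)%N ->
     cond j (if (j < t)%N then comp_coef f (jarc z) (mu + j.+1) else z (tail_coord j.+1))].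

Lemma lcset_tail_set (U : set ('I_n -> R)) (cond : nat -> set R) (t : nat) :
  lcset U -> (forall j, lcset_line (cond j)) -> lcset (tail_set U cond t).
Proof.
move=> hU hc; apply: lcsetI.
  by apply: lcsetI; [apply: lcset_has_order|apply: lcset_lead].
apply: (@lcset_all_lt _ _ (fun j => [set z | cond j
  (if (j < t)%N then comp_coef f (jarc z) (mu + j.+1) else z (tail_coord j.+1))])) => j.
case: (j < t)%N; apply: lcset_line_preim => //; first exact: polyfun_jarc_coef.
exact: polyfun_coord.
Qed.

Lemma has_order_upd z j c : (0 < j <= r)%N ->
  has_order a z -> has_order a (upd z (tail_coord j) c).
Proof.
move=> hj h i; have [h1 h2] := h i; split=> [l hl|]; rewrite jarc_upd // ifN //; first exact: h1.
  by apply/negP => /andP[/eqP ei /eqP el]; move: hl; rewrite ei el; lia.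
by apply/negP => /andP[/eqP ei /eqP el]; move: el hj; rewrite ei; lia.
Qed.

Lemma lead_upd z j c : (0 < j <= r)%N -> lead a (upd z (tail_coord j) c) = lead a z.
Proof.
move=> hj; apply/funext => i; rewrite /lead jarc_upd // ifN //.
by apply/negP => /andP[/eqP ei /eqP el]; move: el hj; rewrite ei; lia.
Qed.

(** The triangularity behind the trade: the coordinate of index j does not enter the earlier
    coefficients, and enters its own affinely, with the partial derivative as slope. *)
Lemma comp_coef_upd z j c j' : (0 < j <= r)%N -> (0 < j' <= j)%N -> has_order a z ->
  comp_coef f (jarc z) (mu + j') = comp_coef f (jarc (upd z (tail_coord j) c)) (mu + j') +
   (if j' == j then (z (tail_coord j) - c) * ev (initform f a mu)^`M(i0) (lead a z) else 0).
Proof.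
move=> hj hj' hz.
rewrite (@comp_coef_varies _ f a (jarc z) (jarc (upd z (tail_coord j) c)) mu j' i0) //.
- rewrite jarc_upd // eqxx eqn_add2l /=; case: eqVneq => [->|ne].
    by rewrite jarc_tail.
  by rewrite subrr mul0r.
- by move=> i l hl; case: (hz i) => + _; apply.
- by case/andP: hj'.
- move=> i l hil; rewrite jarc_upd // ifN //.
  by apply/negP => /andP[/eqP ei /eqP el]; case: hil => [|]; rewrite ?ei ?eqxx // el; lia.
Qed.

(** The last coefficient is traded first. When index t is exchanged, the lower conditions do not
    involve its coordinate, by triangularity, and the higher ones already bear on other coordinates;
    thus the rest [B] is stable under changes of that coordinate, as [cl_eliminate] requires. *)
Lemma cl_tail_set (U : set ('I_n -> R)) (cond : nat -> set R) (t : nat) :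
  lcset U -> (forall j, lcset_line (cond j)) ->
  (forall u, U u -> ev (initform f a mu)^`M(i0) u != 0) -> (t <= r)%N ->
  cl (tail_set U cond t) = cl (tail_set U cond 0).
Proof.
move=> hU hc hD; elim: t => // t ih ht; rewrite -ih; last exact: ltnW.
pose B := [set z : I -> R | (has_order a z /\ U (lead a z)) /\ forall j, (j < r)%N -> j != t ->
     cond j (if (j < t)%N then comp_coef f (jarc z) (mu + j.+1) else z (tail_coord j.+1))].
pose e := tail_coord t.+1.
have ht' : (0 < t.+1 <= r)%N by [].
have e1 : tail_set U cond t.+1 = [set z | B z /\ cond t (comp_coef f (jarc z) (mu + t.+1))].
  apply/seteqP; split=> z /=.
    move=> [h1 h2]; split; last by have := h2 t ht; rewrite ltnSn.
    split=> // j hj ne; have := h2 j hj.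
    by rewrite ltnS leq_eqVlt (negbTE ne).
  move=> [[h1 h2] h3]; split=> // j hj.
  have [->|ne] := eqVneq j t; first by rewrite ltnSn.
  by rewrite ltnS leq_eqVlt (negbTE ne) /=; apply: h2.
have e2 : tail_set U cond t = [set z | B z /\ cond t (z e)].
  apply/seteqP; split=> z /=.
    move=> [h1 h2]; split; last by have := h2 t ht; rewrite ltnn.
    by split=> // j hj ne; apply: h2.
  move=> [[h1 h2] h3]; split=> // j hj.
  by have [->|ne] := eqVneq j t; [rewrite ltnn|apply: h2].
have l1 := lcset_tail_set t.+1 hU hc; have l2 := lcset_tail_set t hU hc.
rewrite e1 e2 in l1 l2 *.
apply: (@cl_eliminate _ e (fun z => ev (initform f a mu)^`M(i0) (lead a z))
  (fun z => comp_coef f (jarc z) (mu + t.+1))) => //.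
- apply: (@polyfun_comp _ _ (lead a)); last exact: polyfun_ev.
  by move=> i; apply: polyfun_jarc.
- exact: polyfun_jarc_coef.
- move=> z c [[h1 h2] h3]; split; first by rewrite lead_upd //; split=> //; apply: has_order_upd.
  move=> j hj ne; have := h3 j hj ne; case: ltnP => hjt.
    rewrite (@comp_coef_upd z t.+1 c j.+1) //; last exact: leqW hjt.
    by rewrite eqSS (negbTE ne) addr0.
  rewrite /upd ifN //; apply/eqP => /tail_coord_inj h; move: ne.
  by rewrite -eqSS h ?eqxx.
- by move=> z c; rewrite lead_upd.
- by move=> z [[_ h] _]; apply: hD.
- move=> z [[h _] _]; rewrite (@comp_coef_upd z t.+1 0 t.+1) ?leqnn //.
  by rewrite eqxx subr0 addrC mulrC.
Qed.

Lemma card_free_tail :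
  #|free_coords :\: [set tail_coord j.+1 | j : 'I_r]%SET|%SET = (N * n + d - (r + \sum_i a i))%N.
Proof.
rewrite cardsD (finset.setIidPr _); last first.
  apply/fintype.subsetP => u /imsetP[j _ ->]; rewrite !inE /= inordK.
    by lia.
  by have := ltn_ord j; have := a0 i0; move: hr; lia.
rewrite card_free_coords card_imset ?card_ord; first by rewrite [(r + _)%N]addnC subnDA.
move=> j j' h; apply: val_inj; apply: succn_inj.
by apply: tail_coord_inj h; rewrite ?ltn_ord.
Qed.

(* Here r = k - mu: all tail conditions but the last one are equations z_e = 0. *)
Lemma cl_tail_set0 (U : set ('I_n -> R)) (S : set R) :
  lcset U -> lcset_line S -> U `<=` torus n -> (0 < r)%N ->
  cl (tail_set U (fun j => if j.+1 == r then S else [set 0]) 0) =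
  cl (prodset (prodset U [set c : 'I_1 -> R | S (c ord0)])
        [set: 'I_(N * n + d - (r + \sum_i a i)) -> R]).
Proof.
move=> hU hS Ut r0.
(* The last tail coordinate carries [S] and the r - 1 others vanish; all r of them therefore leave
   the free coordinates. *)
pose iota (u : 'I_n + 'I_1) : I := match u with inl i => lead_coord i | inr _ => tail_coord r end.
pose B := (free_coords :\: [set tail_coord j.+1 | j : 'I_r]%SET)%SET.
have rr : (0 < r <= r)%N by rewrite r0 leqnn.
have tailF j : (0 < j <= r)%N -> tail_coord j \in free_coords.
  move=> hj; rewrite inE /= inordK; have := a0 i0; move: hr hj; lia.
have leadF i : lead_coord i \notin free_coords.
  by rewrite inE /= inordK ?prednK // -ltnNge ltn_predL a0.
rewrite -(@cl_coord _ _ iota B _ (prodset U [set c | S (c ord0)])).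
- congr cl; apply/seteqP; split=> z.
    move=> [[/has_orderE[ht h] hU'] hc]; split.
      split=> /=.
        by move: hU'; congr U; apply/funext => i; rewrite lead_coordE.
      by have := hc r.-1; rewrite ltn0 prednK // eqxx leqnn => /(_ isT).
    move=> u; rewrite inE negb_and negbK => /orP[/imsetP[j _ ->]|hu] hne.
      have := hc j (ltn_ord j); rewrite ifN //.
      by apply/eqP => e; have := hne (inr ord0); rewrite /= e eqxx.
    by apply: h => // i; apply: (hne (inl i)).
  move=> [[hU' hS'] h].
  have {}hU' : U (lead a z) by move: hU'; congr U; apply/funext => i; rewrite lead_coordE.
  split; first (split=> //; apply/has_orderE => //; split; first exact: Ut).
    move=> u hu hne; apply: h; first by rewrite inE negb_and hu orbT.
    move=> [i|_] /=; first exact: hne.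
    by apply/eqP => e; move: hu; rewrite -e tailF.
  move=> j hj /=; case: eqP => [->//|/eqP ne]; apply: h.
    by rewrite inE negb_and negbK; apply/orP; left; apply/imsetP; exists (Ordinal hj).
  move=> [i|_] /=; apply/eqP => e.
    by have := leadF i; rewrite e tailF.
  by move/tail_coord_inj: e ne => -> //; rewrite eqxx.
- move=> [i|t] [i'|t'] //=.
  + by move=> [->].
  + by move=> e; have := leadF i; rewrite e tailF.
  + by move=> e; have := leadF i'; rewrite -e tailF.
  + by rewrite !ord1.
- move=> [i|t] /=; rewrite inE negb_and; first by rewrite leadF orbT.
  rewrite negbK; apply/orP; left; apply/imsetP.
  have hr' : (r.-1 < r)%N by rewrite prednK.
  by exists (Ordinal hr'); rewrite //= prednK.
- exact: card_free_tail.
- by apply: lcset_prod.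
Qed.

End Tail.
End Order.
End JetSpace.

(** If [a i] exceeded [mu], no monomial of weight [mu] could contain the i-th variable. The bound
    keeps the traded coordinates inside the jet space. *)
Lemma mderiv_initform_bound (n : nat) (f : {mpoly R[n]}) (a : 'I_n -> nat) (mu : nat)
    (i : 'I_n) (c : 'I_n -> R) :
  ev (initform f a mu)^`M(i) c != 0 -> (a i <= mu)%N.
Proof.
rewrite ev_mderiv_initform; apply: contraNT; rewrite -ltnNge => hlt.
apply/eqP; apply: big1 => m /eqP hm.
have m0 : m i = 0%N.
  case e : (m i) => [//|e']; move: hlt; rewrite -hm ltnNge => /negP[].
  by rewrite /wt (bigD1 i) //= e mulnS -addnA leq_addr.
by rewrite mderivX m0 scale0r /ev meval0 mulr0.
Qed.

(** * The class of the jets of one order a, according to the position of m_f(a) relative to k *)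

Section Piece.
Variables (n N' d : nat) (f : {mpoly R[n]}) (k : nat) (S : set R) (a : 'I_n -> nat) (mu : nat).
Local Notation N := N'.+1.
Local Notation I := ('I_n * 'I_N + 'I_d)%type.
Hypotheses (a0 : forall i, (0 < a i)%N) (aN : forall i, (a i <= N)%N).
Hypothesis hmin : forall m, m \in msupp f -> (mu <= wt a m)%N.
Hypotheses (kN : (k <= N)%N) (hS : lcset_line S) (S0 : ~ S 0).

Definition piece : set (I -> R) :=
  [set z | jets f k S (fun p => z (inl p)) /\ has_order a z].

Lemma lcset_piece : lcset piece.
Proof.
apply: lcsetI; last exact: lcset_has_order.
exact: (@lcset_reindex I _ inl _ (@lcset_jets n N' f k S hS)).
Qed.

Lemma jarc_coef_lt (z : I -> R) j : has_order a z -> (j < mu)%N -> comp_coef f (jarc z) j = 0.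
Proof. by move=> hz; apply: comp_coef_lt hmin => i l hl; case: (hz i) => + _; apply. Qed.

Lemma jarc_coef_eq (z : I -> R) : has_order a z ->
  comp_coef f (jarc z) mu = ev (initform f a mu) (lead a z).
Proof. by move=> hz; apply: comp_coef_eq hmin => i l hl; case: (hz i) => + _; apply. Qed.

Lemma piece_gt : (k < mu)%N -> piece = set0.
Proof.
move=> hk; apply/seteqP; split=> // z [[_ h] hz]; apply: S0.
by rewrite -(jarc_coef_lt hz hk).
Qed.

Lemma lead_torus (z : I -> R) : has_order a z -> torus n (lead a z).
Proof. by move=> hz i; case: (hz i). Qed.

Lemma cl_piece_eq : mu = k ->
  cl piece = cl (prodset [set c | torus n c /\ S (ev (initform f a mu) c)]
                   [set: 'I_(N * n + d - \sum_i a i) -> R]).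
Proof.
move=> ek; rewrite -(@cl_order_lead n N' d a a0 aN) //; last 2 first.
- apply: lcsetI; first exact: lcset_torus.
  by apply: lcset_line_preim => //; apply: polyfun_ev.
- by move=> c [].
congr cl; apply/seteqP; split=> z.
  move=> [[_ h] hz]; split=> //; split; first exact: lead_torus.
  by rewrite -jarc_coef_eq // ek.
move=> [hz [_ h]]; split=> //; split=> [j hj|].
  by apply: jarc_coef_lt; rewrite // ek.
by move: h; rewrite -jarc_coef_eq // ek.
Qed.

Definition first_partial (i : 'I_n) : set ('I_n -> R) :=
  [set c | (torus n c /\ ev (initform f a mu) c = 0) /\
     (ev (initform f a mu)^`M(i) c != 0 /\
      forall j : 'I_n, (j < i)%N -> ev (initform f a mu)^`M(j) c = 0)].

Lemma lcset_initform_zero : lcset [set c | torus n c /\ ev (initform f a mu) c = 0].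
Proof.
apply: lcsetI; first exact: lcset_torus.
by apply: lcset_eq0; apply: polyfun_ev.
Qed.

Lemma lcset_first_partial i : lcset (first_partial i).
Proof.
apply: lcsetI; first exact: lcset_initform_zero.
apply: lcsetI; first by apply: lcset_neq0; apply: polyfun_ev.
apply: (@lcset_all _ _ (fun j : 'I_n => [set c : 'I_n -> R | (j < i)%N ->
  ev (initform f a mu)^`M(j) c = 0])) => j.
case: (j < i)%N.
  rewrite (_ : mkset _ = [set c | ev (initform f a mu)^`M(j) c = 0]).
    by apply: lcset_eq0; apply: polyfun_ev.
  by apply/seteqP; split=> c /= h; [apply: h|].
by rewrite (_ : mkset _ = setT); [apply: lcsetT|apply/seteqP; split].
Qed.

Lemma first_partial_inj i j c : first_partial i c -> first_partial j c -> i = j.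
Proof.
move=> [_ [hi hi']] [_ [hj hj']]; apply: val_inj.
by case: (ltngtP i j) => // [/hj'|/hi'] e; [move: hi|move: hj]; rewrite e eqxx.
Qed.

Hypothesis hnd : forall c, torus n c -> ev (initform f a mu) c = 0 ->
  exists i, ev (initform f a mu)^`M(i) c != 0.

Lemma first_partial_exists c : torus n c -> ev (initform f a mu) c = 0 ->
  exists i, first_partial i c.
Proof.
move=> h1 h2; have [i hi] := hnd h1 h2.
pose P (j : nat) := [exists i : 'I_n, (i == j :> nat) && (ev (initform f a mu)^`M(i) c != 0)].
have hP : exists j, P j by exists i; apply/existsP; exists i; rewrite eqxx.
case: (ex_minnP hP) => j /existsP[i' /andP[/eqP e hi']] hmin'.
exists i'; split=> //; split=> // j' hj'; apply/eqP; apply: contraT => hne.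
have := hmin' j'; rewrite leqNgt -e hj' => h; suff : P j' by move/h.
by apply/existsP; exists j'; rewrite eqxx.
Qed.

Lemma cl_piece_first_partial i : (mu < k)%N ->
  cl [set z | piece z /\ first_partial i (lead a z)] =
  cl (prodset (prodset (first_partial i) [set c : 'I_1 -> R | S (c ord0)])
        [set: 'I_(N * n + d - (k - mu + \sum_i a i)) -> R]).
Proof.
(* A point of the stratum is needed to bound [a i] by [mu]; an empty stratum makes both sides
   vanish. *)
move=> hk; have [[c hc]|hne] := pselect (exists c, first_partial i c); last first.
  rewrite (_ : mkset _ = set0); last first.
    by apply/seteqP; split=> // z [_ h]; case: hne; exists (lead a z).
  rewrite (_ : prodset (prodset _ _) _ = set0) ?cl0 //.
  by apply/seteqP; split=> // z [[h _] _]; case: hne; eexists; apply: h.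
have hai : (a i <= mu)%N by case: hc => _ [/mderiv_initform_bound].
have hr : (a i + (k - mu) <= N)%N by move: hk kN hai; lia.
pose r := (k - mu)%N; pose cond j := if j.+1 == r then S else [set 0 : R].
have hcond j : lcset_line (cond j).
  rewrite /cond; case: eqP => // _.
  by apply: lcset_eq0; apply: polyfun_coord.
rewrite -(@cl_tail_set0 n N' d a a0 aN f mu r i hr) //; last 3 first.
- exact: lcset_first_partial.
- by move=> u [[]].
- by rewrite /r subn_gt0.
rewrite -(@cl_tail_set n N' d a a0 f mu r i hmin hr _ cond r) //; last 2 first.
- exact: lcset_first_partial.
- by move=> u [_ []].
congr cl; apply/seteqP; split=> z.
  move=> [[[h1 h2] hz] hU]; split=> // j hj; rewrite hj /cond.
  case: eqP => [e|/eqP ne]; first by rewrite e /r subnKC // ltnW.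
  by apply: h1; move: hj ne; rewrite /r; lia.
move=> [[hz hU] h]; split=> //; split=> //; split=> [j hj|].
  case: (ltngtP j mu) => hjm.
  - exact: jarc_coef_lt.
  (* The coefficient of t^j with mu < j < k is the condition of index j - mu - 1, which is not the
     last one and hence an equation. *)
  - have hj' : (j - mu.+1 < r)%N by rewrite /r; move: hj hjm; lia.
    have := h _ hj'; rewrite hj' /cond ifN; last by rewrite /r; move: hj hjm; lia.
    by rewrite (_ : (mu + (j - mu.+1).+1)%N = j) //; move: hjm; lia.
  - by rewrite hjm; have := jarc_coef_eq hz; case: hU => [[_ ->] _].
have hr' : (r.-1 < r)%N by rewrite /r; move: hk; lia.
have := h _ hr'; rewrite hr' /cond prednK ?eqxx; last by rewrite /r subn_gt0.
by rewrite subnKC // ltnW.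
Qed.

(** The strata of the first nonzero partial derivative are used twice: to cut the piece, and
    backwards to reassemble the zero locus in the product. *)
Lemma cl_piece_lt : (mu < k)%N ->
  cl piece = cl (prodset (prodset [set c | torus n c /\ ev (initform f a mu) c = 0]
                                  [set c : 'I_1 -> R | S (c ord0)])
                   [set: 'I_(N * n + d - (k - mu + \sum_i a i)) -> R]).
Proof.
move=> hk.
rewrite (@cl_partition _ 'I_n _ (fun i => [set z | piece z /\ first_partial i (lead a z)])).
- rewrite (eq_bigr _ (fun i _ => cl_piece_first_partial i hk)); apply/esym/cl_partition.
  + apply: lcset_prod; last exact: lcsetT.
    by apply: lcset_prod => //; apply: lcset_initform_zero.
  + move=> i; apply: lcset_prod; last exact: lcsetT.
    by apply: lcset_prod => //; apply: lcset_first_partial.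
  + move=> z; split=> [[[[h1 h2] hs] _]|[i [[[h _] hs] _]]]; last by [].
    by have [i hi] := first_partial_exists h1 h2; exists i.
  + by move=> i j z [[h1 _] _] [[h2 _] _]; apply: first_partial_inj h1 h2.
- exact: lcset_piece.
- by move=> i; apply: lcsetI; [apply: lcset_piece|apply: lcset_lead; apply: lcset_first_partial].
- move=> z; split=> [hp|[i []//]].
  have [[h1 _] hz] := hp.
  have [|i hi] := @first_partial_exists (lead a z) (lead_torus hz).
    by rewrite -jarc_coef_eq // h1.
  by exists i.
- by move=> i j z [_ h1] [_ h2]; apply: first_partial_inj h1 h2.
Qed.

End Piece.

(** * Summation over orders and faces *)

Section Decomposition.
Variables (n N' d : nat) (f : {mpoly R[n]}) (k : nat) (S : set R).
Local Notation N := N'.+1.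
Local Notation Ix := ('I_n * 'I_N)%type.
Local Notation I := (Ix + 'I_d)%type.
Local Notation JS := (@jets n N' f k S).
Hypothesis hS : lcset_line S.

Definition degenerate_jets : set (Ix -> R) := [set x | exists i, forall l, x (i, l) = 0].

(** The choice of a component becomes a product, and the vanishing of all its coefficients a sum of
    squares. *)
Lemma zset_degenerate_jets : zset degenerate_jets.
Proof.
exists (fun x => \prod_i \sum_l x (i, l) ^+ 2).
  apply: polyfun_prod => i; apply: polyfun_sum => l.
  exact/polyfunX/polyfun_coord.
apply/seteqP; split=> x /=.
  by move=> [i hi]; rewrite (bigD1 i) //= big1 ?mul0r // => l _; rewrite hi expr0n.
move/eqP/prodf_eq0 => [i _]; rewrite psumr_eq0 => [/allP h|l _]; last exact: sqr_ge0.
by exists i => l; have /= := h l (mem_index_enum l); rewrite sqrf_eq0 => /eqP.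
Qed.

Lemma has_order_pos (a : 'I_n -> nat) (z : I -> R) : has_order a z -> forall i, (0 < a i)%N.
Proof.
move=> h i; have [_] := h i; rewrite lt0n; apply: contra => /eqP->.
by rewrite /jarc /jet_arc.
Qed.

Lemma has_order_inj (a b : {ffun 'I_n -> 'I_N.+1}) (z : I -> R) :
  has_order (fun i => a i) z -> has_order (fun i => b i) z -> a = b.
Proof.
move=> ha hb; apply/ffunP => i; apply: val_inj.
have [ha1 ha2] := ha i; have [hb1 hb2] := hb i.
by case: (ltngtP (a i) (b i)) => // [/hb1|/ha1] e; [move: ha2|move: hb2]; rewrite e eqxx.
Qed.

Lemma has_order_exists (z : I -> R) : ~ degenerate_jets (fun p => z (inl p)) ->
  exists a : {ffun 'I_n -> 'I_N.+1}, has_order (fun i => a i) z.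
Proof.
move=> hz.
have hex i : exists t : 'I_N.+1, (forall l, (l < t)%N -> jarc z i l = 0) /\ jarc z i t != 0.
  pose P j := (j <= N)%N && (jarc z i j != 0).
  have hP : exists j, P j.
    apply: contrapT => hn; apply: hz; exists i => l; apply: contrapT => /eqP hl.
    apply: hn; exists l.+1; rewrite /P ltn_ord /=.
    by rewrite /jarc /jet_arc /= ltn_ord inord_val.
  case: (ex_minnP hP) => j /andP[hj hj'] hmin.
  exists (Ordinal (n := N.+1) (m := j) hj); split=> // l hl; apply/eqP/contraT => hne.
  have := hmin l; rewrite leqNgt hl => h; suff : P l by move/h.
  by rewrite /P hne (leq_trans (ltnW hl)).
have [g hg] := boolp.choice hex.
by exists [ffun i => g i] => i; rewrite ffunE.
Qed.

Lemma cl_jets :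
  cl (prodset (JS) [set: 'I_d -> R]) =
  cl (prodset (JS `&` degenerate_jets) [set: 'I_d -> R]) +
  \sum_(a : {ffun 'I_n -> 'I_N.+1}) cl (@piece n N' d f k S (fun i => a i)).
Proof.
have hX : lcset (prodset (JS) [set: 'I_d -> R]).
  by apply: lcset_prod; [apply: (@lcset_jets n N' f k S)|apply: lcsetT].
have zC : zset [set z : I -> R | degenerate_jets (fun p => z (inl p))].
  by case: zset_degenerate_jets => p hp ->; exists (fun z => p (fun i => z (inl i)));
    first exact: polyfun_reindex.
rewrite (cl_scissor hX zC); congr (_ + _).
  by congr cl; apply/seteqP; split=> z; rewrite /prodset /=; tauto.
apply: cl_partition.
- by rewrite setDE; apply: lcsetI => //; apply: zsetC_lc.
- by move=> a; apply: (@lcset_piece n N' d f k S).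
- move=> z; split.
    by move=> [[hz _] /has_order_exists[a ha]]; exists a.
  move=> [a [h1 h2]]; split=> // -[i hi].
  have [_] := h2 i; rewrite /jarc /jet_arc; case: ifP => _; last by rewrite eqxx.
  by rewrite hi eqxx.
- by move=> a b z [_ h1] [_ h2]; apply: has_order_inj h1 h2.
Qed.

Definition degenerate_gen : gen :=
  @Gen #|{: Ix}| [set v | (JS `&` degenerate_jets) (fun il => v (enum_rank il))].

Lemma lcset_degenerate : lcset (JS `&` degenerate_jets).
Proof.
apply: lcsetI; first exact: (@lcset_jets n N' f k S).
exact/zset_lc/zset_degenerate_jets.
Qed.

Lemma glclosed_degenerate : glclosed degenerate_gen.
Proof. by apply/lclosedP; apply: lcset_reindex; apply: lcset_degenerate. Qed.

(** N n - M + 1 is more than N (n - 1), so the chosen coordinates cannot avoid any component.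
    Whichever component of a degenerate jet is zero, the product of the chosen coordinates vanishes
    on it. *)
Lemma dimle_degenerate (M : nat) : (M <= N)%N ->
  dimle degenerate_gen ((N * n)%:Z - M%:Z).
Proof.
(* For n = 0 the bound may be negative, and [dimle] then asks for the empty set; it is empty, as
   there is no component to vanish. *)
move=> MN; case: (pickP (fun _ : 'I_n => true)) => [i0 _|e]; last first.
  have g0 : gset degenerate_gen = set0.
    by apply/seteqP; split=> // v [_ [i _]]; have := e i.
  move: ((N * n)%:Z - M%:Z) => [d'|d'] /=; last exact: g0.
  move=> sigma _; exists 1; split; first exact: oner_neq0.
  by move=> x hx; have : gset degenerate_gen x by []; rewrite g0.
have hn : (0 < n)%N by case: (n) i0 => [[]|].
rewrite subzn; last by apply: leq_trans MN _; rewrite leq_pmulr.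
move=> /= sigma inj; exists (\prod_j 'X_j); split.
  apply/prodf_neq0 => j _; apply/eqP => /(congr1 (meval (fun=> 1))).
  by rewrite mevalXU meval0 => /eqP; rewrite oner_eq0.
move=> x [_ [i hi]].
have [/existsP[j /eqP hj]|hne] := boolP [exists j, (enum_val (sigma j)).1 == i].
  rewrite /ev rmorph_prod /= (bigD1 j) //= mevalXU.
  rewrite -[sigma j]enum_valK (surjective_pairing (enum_val _)) hj hi mul0r //.
suff : (#|'I_(N * n - M).+1| <= n.-1 * N)%N.
  rewrite card_ord => h; exfalso; move: h hn MN; case: (n) => // n' /=.
  by rewrite mulnS [(n' * _)%N]mulnC; lia.
have -> : (n.-1 * N = #|[set p : Ix | p.1 != i]%SET|)%N.
  rewrite (_ : [set p : Ix | p.1 != i]%SET = finset.setX [set~ i]%SET [set: 'I_N]%SET).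
    by rewrite cardsX cardsC1 cardsT !card_ord.
  by apply/setP => p; rewrite !inE andbT.
rewrite -(card_imset predT (f := fun j => enum_val (sigma j))); last first.
  by move=> j j' /enum_val_inj/inj.
apply: subset_leq_card; apply/fintype.subsetP => p /imsetP[j _ ->].
rewrite inE; apply: contra hne => h; apply/existsP; exists j; exact: h.
Qed.

Lemma valL_jetseq : (k <= N)%N ->
  valL (N * n + d) (jetseq (arcs f k S) N) = cl (prodset (JS) [set: 'I_d -> R]).
Proof.
move=> kN; rewrite /valL big_seq1 /= addKn gset_pjet // mulr1z gclass_gen_affine //.
exact: (@lcset_jets n N' f k S).
Qed.

Lemma valL_degenerate :
  valL (N * n + d) [:: ((1, (N * n)%N), degenerate_gen)] =
  cl (prodset (JS `&` degenerate_jets) [set: 'I_d -> R]).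
Proof.
rewrite /valL big_seq1 /= addKn mulr1z gclass_gen_affine //.
exact: lcset_degenerate.
Qed.

End Decomposition.

Lemma big_NoDup_eq (V : nmodType) (T : Type) (s : seq T) (t0 : T) (A B : Prop) (F : T -> V) :
  List.NoDup s -> List.In t0 s ->
  \sum_(t <- s) (if `[< A /\ t0 = t /\ B >] then F t else 0) =
  if `[< A /\ B >] then F t0 else 0.
Proof.
elim: s => [_ []|t s ih] hnd; inversion hnd; subst => /= hin.
rewrite big_cons; have [e|ne] := pselect (t = t0).
  rewrite e in H1 *; rewrite [X in _ + X](_ : _ = 0) ?addr0.
    by congr (if _ then _ else _); apply: asbool_equiv_eq; tauto.
  elim: s H1 {ih hnd hin H2} => [|u s ih] h; first by rewrite big_nil.
  rewrite big_cons ih ?addr0; last by move=> h'; apply: h; right.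
  case: asboolP => // -[_ [e' _]]; case: h; left; by rewrite e'.
case: hin => [//|hin]; rewrite ih //; case: asboolP => [[_ [e _]]|_]; last by rewrite add0r.
by case: ne.
Qed.

Lemma flatten_additive (V : nmodType) (h : fsum -> V) (T : Type) (s : seq T) (F : T -> fsum) :
  h [::] = 0 -> (forall x y, h (x ++ y) = h x + h y) ->
  h (flatten [seq F t | t <- s]) = \sum_(t <- s) h (F t).
Proof.
move=> h0 hD; elim: s => [|t s ih] /=; first by rewrite h0 big_nil.
by rewrite hD ih big_cons.
Qed.

Section SumOverFaces.
Variables (n : nat) (f : {mpoly R[n]}) (k : nat) (fl : seq (set ('I_n -> R))).
Hypotheses (hnd : List.NoDup fl) (hfl : forall g, face f g <-> List.In g fl).
Variables (V : nmodType) (h : set ('I_n -> R) -> fsum -> V).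
Hypotheses (h0 : forall g, h g [::] = 0) (hD : forall g x y, h g (x ++ y) = h g x + h g y).

Lemma gammaf_avec_In (N : nat) (a : {ffun 'I_n -> 'I_N.+1}) : List.In (gammaf f (avec a)) fl.
Proof. by apply/hfl; apply: (face_gammaf f (fun i => a i)). Qed.

(** Each [a] exposes exactly one face of the list, so the double sum collapses to a sum over orders.
    The additive map [h g] abstracts multiplication by the class attached to the face, followed by
    evaluation in a group. *)
Lemma sum_Pk (N : nat) :
  \sum_(g <- fl) h g (Pk f k N g) =
  \sum_(a : {ffun 'I_n -> 'I_N.+1})
    if `[< apos a /\ mf f (avec a) = k%:R >] then h (gammaf f (avec a)) (Lneg (sa a)) else 0.
Proof.
under eq_bigr do rewrite /Pk flatten_additive //.
rewrite exchange_big /= big_enum; apply: eq_bigr => a _.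
rewrite -(@big_NoDup_eq _ _ fl _ _ _ (fun g => h g (Lneg (sa a)))) //; last first.
  exact: gammaf_avec_In.
by apply: eq_bigr => g _; case: ifP.
Qed.

Lemma sum_Qk (N : nat) :
  \sum_(g <- fl) h g (Qk f k N g) =
  \sum_(a : {ffun 'I_n -> 'I_N.+1}) \sum_(j <- iota 0 k)
    if `[< apos a /\ mf f (avec a) = j%:R >]
    then h (gammaf f (avec a)) (Lneg (k - j + sa a)) else 0.
Proof.
under eq_bigr do rewrite /Qk flatten_additive //.
rewrite exchange_big /= big_enum; apply: eq_bigr => a _.
under eq_bigr do rewrite flatten_additive //.
rewrite exchange_big /=; apply: eq_bigr => j _.
rewrite -(@big_NoDup_eq _ _ fl _ _ _ (fun g => h g (Lneg (k - j + sa a)))) //; last first.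
  exact: gammaf_avec_In.
by apply: eq_bigr => g _; case: ifP.
Qed.

End SumOverFaces.

(** * Bounds on the exponents of L *)

Definition level_le (J : nat) (x : fsum) : bool := all (fun p => (p.1.2 <= J)%N) x.

Lemma level_le_opp (J : nat) (x : fsum) : level_le J (fopp x) = level_le J x.
Proof. by rewrite /level_le all_map; apply: eq_all. Qed.

Lemma level_le_sub (J : nat) (x y : fsum) :
  level_le J x -> level_le J y -> level_le J (fsub x y).
Proof.
move=> hx hy; rewrite /level_le all_cat; apply/andP; split=> //.
by rewrite -/(level_le J (fopp y)) level_le_opp.
Qed.

Lemma level_le_mul (J : nat) (x y : fsum) :
  level_le 0 x -> level_le J y -> level_le J (fmul x y).
Proof.
move=> hx hy; rewrite /fmul; elim: x hx => [|p x ih] //= /andP[hp hx].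
rewrite /level_le all_cat; apply/andP; split; last exact: ih.
elim: y hy {ih} => [|q y ih] //= /andP[hq hy]; rewrite ih // andbT.
by move: hp; rewrite leqn0 => /eqP ->.
Qed.

Lemma level_le_flatten (J : nat) (T : Type) (s : seq T) (F : T -> fsum) :
  (forall t, level_le J (F t)) -> level_le J (flatten [seq F t | t <- s]).
Proof.
move=> h; elim: s => [|t s ih] //=; rewrite /level_le all_cat.
by apply/andP; split; [apply: h|apply: ih].
Qed.

Lemma sa_le (n N : nat) (a : {ffun 'I_n -> 'I_N.+1}) : (sa a <= N * n)%N.
Proof.
apply: (@leq_trans (\sum_(i < n) N)%N); first by apply: leq_sum => i _; rewrite -ltnS.
by rewrite sum_nat_const card_ord mulnC.
Qed.

Lemma level_le_Pk (n : nat) (f : {mpoly R[n]}) (k N : nat) g :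
  level_le (N * n + k) (Pk f k N g).
Proof.
apply: level_le_flatten => a; case: ifP => // _.
by rewrite /level_le /= andbT; apply: leq_trans (leq_addr _ _); apply: sa_le.
Qed.

(** Exponents can exceed the jet dimension N n here, by at most k; hence k idle coordinates. *)
Lemma level_le_Qk (n : nat) (f : {mpoly R[n]}) (k N : nat) g :
  level_le (N * n + k) (Qk f k N g).
Proof.
apply: level_le_flatten => a; apply: level_le_flatten => j; case: ifP => // _.
by rewrite /level_le /= andbT addnC leq_add ?sa_le ?leq_subr.
Qed.

Lemma level_le_torus (n : nat) : level_le 0 (fpow (fsub fL fone) n).
Proof. by elim: n => // n ih; apply: level_le_mul. Qed.

Lemma mf_avec (n N : nat) (f : {mpoly R[n]}) (a : {ffun 'I_n -> 'I_N.+1}) (mu j : nat) :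
  is_minwt f (fun i => a i) mu -> mf f (avec a) = j%:R <-> mu = j.
Proof.
move=> hmu; rewrite (_ : mf f (avec a) = mu%:R); last exact: (mf_minwt hmu).
by split=> [/eqP|->//]; rewrite eqr_nat => /eqP.
Qed.

Definition torus_locus (n : nat) (p : {mpoly R[n]}) (S : set R) : set ('I_n -> R) :=
  [set c | torus n c /\ S (ev p c)].

(** Common to the three cases of [S]. The maps [hP] and [hQ] evaluate at level J the product with
    the class attached to a face; their values on [Lneg e] suffice, since [Pk] and [Qk] are lists of
    such terms. *)
Lemma same_limit_arcs (n : nat) (f : {mpoly R[n]}) (k : nat) (fl : seq (set ('I_n -> R)))
    (S : set R) (rhs : nat -> fsum) (hP hQ : nat -> set ('I_n -> R) -> fsum -> K0) :
  newton_nondegenerate f -> (1 <= k)%N ->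
  List.NoDup fl -> (forall g, face f g <-> List.In g fl) ->
  lcset_line S -> ~ S 0 ->
  (forall J g, hP J g [::] = 0) -> (forall J g x y, hP J g (x ++ y) = hP J g x + hP J g y) ->
  (forall J g, hQ J g [::] = 0) -> (forall J g x y, hQ J g (x ++ y) = hQ J g x + hQ J g y) ->
  (forall J e g, hP J g (Lneg e) =
     cl (prodset (torus_locus (fface f g) S) [set: 'I_(J - e) -> R])) ->
  (forall J e g, hQ J g (Lneg e) =
     cl (prodset (prodset (torus_locus (fface f g) [set 0]) [set c : 'I_1 -> R | S (c ord0)])
           [set: 'I_(J - e) -> R])) ->
  (forall N, level_le (N * n + k) (rhs N)) ->
  (forall N J, valL J (rhs N) =
     \sum_(g <- fl) hP J g (Pk f k N g) + \sum_(g <- fl) hQ J g (Qk f k N g)) ->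
  same_limit (jetseq (arcs f k S)) rhs.
Proof.
move=> hnd k0 hdup hfl hS S0 hP0 hPD hQ0 hQD hPL hQL hlev hval M.
(* N >= k makes the N-jet decide membership, and N >= M gives the dimension bound on degenerate
   jets. *)
exists (k + M)%N => -[|N'] hN; first by move: k0 hN; lia.
have kN : (k <= N'.+1)%N by apply: leq_trans hN; apply: leq_addr.
have MN : (M <= N'.+1)%N by apply: leq_trans hN; apply: leq_addl.
set N := N'.+1 in hN kN MN *.
(* The error term is exactly the class of the degenerate jets divided by L^(N n). *)
exists 1%N, (fun=> 1), (fun=> (N * n)%N), (fun=> @degenerate_gen n N' f k S); split.
  by move=> _; split; [apply: glclosed_degenerate|apply: dimle_degenerate].
rewrite (_ : [seq _ | t <- enum 'I_1] = [:: ((1, (N * n)%N), @degenerate_gen n N' f k S)]); last first.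
  by rewrite enum_ordSl (size0nil (size_enum_ord 0)).
have hl : level_le (N * n + k) (fsub (fsub (jetseq (arcs f k S) N) (rhs N))
    [:: ((1, (N * n)%N), @degenerate_gen n N' f k S)]).
  apply: level_le_sub; last by rewrite /level_le /= leq_addr.
  by apply: level_le_sub => //; rewrite /level_le /= leq_addr.
apply: (Lzero_valL hl).
rewrite !valL_sub valL_jetseq // valL_degenerate // cl_jets // addrAC [X in X - _ - _]addrC.
rewrite addrK hval (sum_Pk k hdup hfl (hP0 _) (hPD _)) (sum_Qk k hdup hfl (hQ0 _) (hQD _)).
rewrite -big_split /=; apply/eqP; rewrite subr_eq0; apply/eqP; apply: eq_bigr => a _.
(* Jets have no constant term, so an order with a zero entry gives an empty piece; [apos] discards
   it on the other side. *)
have [ap|nap] := pselect (apos a); last first.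
  rewrite (_ : piece _ _ _ _ = set0); last first.
    apply/seteqP; split=> // z [_ /has_order_pos hpos]; apply: nap; exact/forallP.
  rewrite cl0; case: asboolP => [[]//|_]; rewrite add0r big1 // => j _.
  by case: asboolP => // -[].
have a0 i : (0 < a i)%N by move/forallP: ap.
have aN i : (a i <= N)%N by rewrite -ltnS.
have [mu hmu] := minwt_exists (fun i => a i : nat) (nondegenerate_msupp hnd).
have hface : fface f (gammaf f (avec a)) = initform f (fun i => a i) mu.
  exact: (fface_initform hmu).
have hmin := hmu.1.
(* Positive weights expose a compact face, to which non-degeneracy applies. *)
have hnd' c : torus n c -> ev (initform f (fun i => a i) mu) c = 0 ->
    exists i, ev (initform f (fun i => a i) mu)^`M(i) c != 0.
  rewrite -hface => hc; apply: hnd => //; first exact: (face_gammaf f (fun i => a i)).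
  exact: compact_gammaf.
have hPif : `[< apos a /\ mf f (avec a) = k%:R >] = (mu == k).
  by apply/asboolP/eqP => [[_ /(mf_avec _ hmu)]//|e]; split=> //; apply/(mf_avec _ hmu).
have hQif j : `[< apos a /\ mf f (avec a) = j%:R >] = (mu == j).
  by apply/asboolP/eqP => [[_ /(mf_avec _ hmu)]//|e]; split=> //; apply/(mf_avec _ hmu).
rewrite hPif; under eq_bigr do rewrite hQif.
rewrite hPL; under eq_bigr do rewrite hQL.
rewrite hface /sa.
have [kmu|muk|emu] := ltngtP k mu.
- rewrite (piece_gt _ _ hmin S0) // cl0 add0r big1_seq // => j /andP[_].
  rewrite mem_iota add0n => /andP[_ hj].
  by rewrite gtn_eqF // (ltn_trans hj).
- rewrite add0r (bigD1_seq mu) ?iota_uniq //=; last by rewrite mem_iota.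
  rewrite eqxx [X in _ + X]big1 ?addr0; last by move=> j /negbTE; rewrite eq_sym => ->.
  exact: (cl_piece_lt k a0 aN hmin kN hS hnd' muk).
- rewrite [X in _ + X]big1_seq ?addr0; last first.
    move=> j /andP[_]; rewrite mem_iota add0n => /andP[_ hj].
    by rewrite -emu gtn_eqF.
  exact: (cl_piece_eq k a0 aN hmin hS (esym emu)).
Qed.

(** * The formulas for nonzero and for signed leading coefficients *)

Lemma lcset_torus_locus (n : nat) (p : {mpoly R[n]}) (S : set R) :
  lcset_line S -> lcset (torus_locus p S).
Proof.
move=> hS; apply: lcsetI; first exact: lcset_torus.
exact: (@lcset_line_preim _ (ev p) S hS (polyfun_ev p)).
Qed.

Lemma lcset_line_neq0 : lcset_line [set c | c != 0].
Proof. exact: (lcset_neq0 (polyfun_coord (ord0 : 'I_1))). Qed.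

Lemma lcset_line1 (s : R) : lcset_line [set c | c = s].
Proof.
rewrite /lcset_line (_ : mkset _ = [set c : 'I_1 -> R | c ord0 - s = 0]).
  apply: (@lcset_eq0 'I_1 (fun c => c ord0 - s)).
  exact: (@polyfunB 'I_1 (fun c => c ord0) (fun=> s) (polyfun_coord ord0) (polyfun_cst _ s)).
by apply/seteqP; split=> c /= => [->|/eqP]; rewrite ?subrr // subr_eq0 => /eqP.
Qed.

Lemma represents_Xg (n : nat) (f : {mpoly R[n]}) g :
  represents 0 (cls (Xg f g)) (torus_locus (fface f g) [set c | c = 0]).
Proof.
apply: represents_cls; apply/lclosedP.
exact: (lcset_torus_locus (fface f g) (lcset_line1 _)).
Qed.

Lemma represents_Xgpm (n : nat) (f : {mpoly R[n]}) g (s : bool) :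
  represents 0 (cls (Xgpm f g s)) (torus_locus (fface f g) [set c | c = if s then 1 else -1]).
Proof.
apply: represents_cls; apply/lclosedP.
exact: (lcset_torus_locus (fface f g) (lcset_line1 _)).
Qed.

Lemma represents_torus_minus_Xg (n : nat) (f : {mpoly R[n]}) g :
  represents 0 (fsub (fpow (fsub fL fone) n) (cls (Xg f g)))
    (torus_locus (fface f g) [set c | c != 0]).
Proof.
have -> : torus_locus (fface f g) [set c | c != 0] =
    torus n `\` [set c | ev (fface f g) c = 0].
  by apply/seteqP; split=> c [h1 h2]; split=> //; apply/eqP.
apply: represents_sub; [exact: represents_torus|exact: represents_Xg|].
by exists (ev (fface f g)) => //; apply: polyfun_ev.
Qed.

Lemma fmul_cls_cat (g : gen) (x y : fsum) :
  fmul (cls g) (x ++ y) = fmul (cls g) x ++ fmul (cls g) y.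
Proof. by rewrite /fmul /= !cats0 map_cat. Qed.

Lemma valL_fsumL (J : nat) (T : Type) (s : seq T) (F : T -> fsum) :
  valL J (fsumL s F) = \sum_(t <- s) valL J (F t).
Proof. exact: valL_flatten. Qed.

(** With [S] the nonzero reals, the coordinate carrying [S] ranges over a punctured line, whence the
    factor L - 1 of the second sum. *)
Lemma same_limit_Ak (n : nat) (f : {mpoly R[n]}) (k : nat) (fl : seq (set ('I_n -> R))) :
  newton_nondegenerate f -> (1 <= k)%N ->
  List.NoDup fl -> (forall g, face f g <-> List.In g fl) ->
  same_limit (jetseq (Ak f k)) (rhsA f k fl).
Proof.
move=> hnd k0 hdup hfl.
apply: (@same_limit_arcs n f k fl [set c | c != 0] _
  (fun J g y => valL J (fmul (fsub (fpow (fsub fL fone) n) (cls (Xg f g))) y))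
  (fun J g y => valL J (fmul (fsub fL fone) (fmul (cls (Xg f g)) y)))) => //.
- exact: lcset_line_neq0.
- by rewrite /= eqxx.
- by move=> J g; rewrite valL_mul0.
- by move=> J g x y; rewrite valL_mul_cat.
- by move=> J g; rewrite [fmul (cls _) _]/fmul /= valL_mul0.
- by move=> J g x y; rewrite fmul_cls_cat valL_mul_cat.
- move=> J e g; apply: represents_valL; apply: represents_mulL.
  exact: represents_torus_minus_Xg.
- move=> J e g.
  have h := represents_mul represents_punctured_line
    (represents_mulL e (represents_Xg f g)).
  rewrite (represents_valL J h) add0n.
  have l1 := lcset_torus_locus (fface f g) (lcset_line1 0).
  have l2 : lcset [set c : 'I_1 -> R | c ord0 != 0] := lcset_line_neq0.
  have lT := lcsetT 'I_(J - e).
  rewrite -!cl_prodA //; last exact: lcset_torus.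
  rewrite cl_prodCA //; last exact: lcset_torus.
  congr (cl (prodset _ (prodset _ _))).
  apply/seteqP; split=> c /=; first exact.
  by move=> hc i; rewrite ord1.
- move=> N; rewrite /rhsA /fadd /level_le all_cat; apply/andP; split.
    apply: level_le_flatten => g; apply: level_le_mul; last exact: level_le_Pk.
    by apply: level_le_sub => //; apply: level_le_torus.
  apply: level_le_mul => //; apply: level_le_flatten => g.
  by apply: level_le_mul => //; apply: level_le_Qk.
- move=> N J; rewrite /rhsA /fadd valL_cat valL_fsumL; congr (_ + _).
  exact: valL_mul_flatten.
Qed.

(** Now [S] is a point, so the coordinate carrying it contributes the factor 1, by
    [cl_prod_point]. *)
Lemma same_limit_Akpm (n : nat) (f : {mpoly R[n]}) (k : nat) (s : bool)
    (fl : seq (set ('I_n -> R))) :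
  newton_nondegenerate f -> (1 <= k)%N ->
  List.NoDup fl -> (forall g, face f g <-> List.In g fl) ->
  same_limit (jetseq (Akpm f k s)) (rhsApm f k s fl).
Proof.
move=> hnd k0 hdup hfl.
apply: (@same_limit_arcs n f k fl [set c | c = if s then 1 else -1] _
  (fun J g y => valL J (fmul (cls (Xgpm f g s)) y))
  (fun J g y => valL J (fmul (cls (Xg f g)) y))) => //.
- exact: lcset_line1.
- by move/eqP; case: (s); rewrite eq_sym ?oppr_eq0 oner_eq0.
- by move=> J g; rewrite valL_mul0.
- by move=> J g x y; rewrite valL_mul_cat.
- by move=> J g; rewrite valL_mul0.
- by move=> J g x y; rewrite valL_mul_cat.
- move=> J e g; apply: represents_valL; apply: represents_mulL.
  exact: represents_Xgpm.
- move=> J e g.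
  rewrite (represents_valL J (represents_mulL e (represents_Xg f g))).
  have l1 := lcset_torus_locus (fface f g) (lcset_line1 0).
  have l2 : lcset [set c : 'I_1 -> R | c ord0 = if s then 1 else -1] := lcset_line1 _.
  have lT := lcsetT 'I_(J - e).
  rewrite -cl_prodA // cl_prodCA // cl_prod_point //.
  exact: lcset_prod.
- move=> N; rewrite /rhsApm /fadd /level_le all_cat; apply/andP; split.
    apply: level_le_flatten => g; apply: level_le_mul; last exact: level_le_Pk.
    by [].
  apply: level_le_flatten => g; apply: level_le_mul; last exact: level_le_Qk.
  by [].
- by move=> N J; rewrite /rhsApm /fadd valL_cat !valL_fsumL.
Qed.

(* fl is any duplicate-free enumeration of the (finitely many) faces of
   Gamma_+(f); the sums over gamma are sums over fl. *)
Theorem mainTheorem3 (n : nat) (f : {mpoly R[n]}) (k : nat)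
    (fl : seq (set ('I_n -> R))) :
  newton_nondegenerate f ->
  ev f (fun _ => 0%R) = 0%R ->
  (1 <= k)%N ->
  List.NoDup fl ->
  (forall g, face f g <-> List.In g fl) ->
  same_limit (jetseq (Ak f k)) (rhsA f k fl) /\
  same_limit (jetseq (Akpm f k true)) (rhsApm f k true fl) /\
  same_limit (jetseq (Akpm f k false)) (rhsApm f k false fl).
Proof.
move=> hnd _ k0 hdup hfl; split; first exact: same_limit_Ak.
by split; apply: same_limit_Akpm.
Qed.
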